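(* In the sequential setting described in the context, suppose that for all $t\in[T]$ and all states $s\in\mathcal{S}$, $F_t(\cdot;s)$ is normalized, monotone, submodular and has bounded marginals. Then for every $t$, $\tilde f_t(\cdot;s_t)$ is nonnegative, monotone and DR-submodular on $\mathcal{P}(\mathcal{I}_t)$, and for all $\mathbf{x},\mathbf{y}\in\mathcal{F}_t$, $\frac12\tilde f_t(\mathbf{y};s_t)-\tilde f_t(\mathbf{x};s_t)\le\frac12\langle\nabla\tilde f_t(\mathbf{x};s_t),\mathbf{y}-\mathbf{x}\rangle$. Let $\eta>0$ be a constant and let $\{\mathbf{x}_t\}_{t=1}^T$, $\mathbf{x}_t\in\mathcal{F}_t$, be the marginal sequence generated by $$\bar{\mathbf{x}}_{t+1}=\Pi_{\mathcal{F}_t}(\mathbf{x}_t+\eta\,\mathbf{g}_t),\qquad \mathbf{x}_{t+1}=\Pi_{\mathcal{F}_{t+1}}(\bar{\mathbf{x}}_{t+1}),$$ where $\mathbf{g}_t$ is a stochastic gradient estimator with $\mathbb{E}[\mathbf{g}_t\mid\mathbf{x}_t,s_t]=\nabla\tilde f_t(\mathbf{x}_t;s_t)$ and finite variance, and let $\pi$ be the policy that at round $t$ plays the factorized categorical policy with marginals $\mathbf{x}_t$. Then, with $D,G,\sigma,\mathcal{P}_T$ as in the context, $$\mathbb{E}\big[\mathrm{Regret}_T^{1/2}(\pi)\big]\;\le\;\frac{D^2}{4\eta}+\frac{D\,\mathcal{P}_T}{2\eta}+\frac{\eta\,T(G^2+\sigma^2)}{4}.$$ Moreover, if $D>0$,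 $G^2+\sigma^2>0$ and the step size is $\eta=\eta^*=\sqrt{\dfrac{D(D+2\mathcal{P}_T)}{T(G^2+\sigma^2)}}$, then $$\mathbb{E}\big[\mathrm{Regret}_T^{1/2}(\pi)\big]\;\le\;\frac12\sqrt{D(D+2\mathcal{P}_T)\,T\,(G^2+\sigma^2)}.$$
   Context: For each round $t\in[T]=\{1,\dots,T\}$: $\mathcal{N}_t$ is a finite set of active agents; agent $i\in\mathcal{N}_t$ has a finite nonempty action set $\mathcal{A}_{i,t}$; $\Omega_t=\{(i,a): i\in\mathcal{N}_t, a\in\mathcal{A}_{i,t}\}$, $\Omega_{i,t}=\{(i,a):a\in\mathcal{A}_{i,t}\}$; $\mathcal{I}_t=\{A\subseteq\Omega_t:|A\cap\Omega_{i,t}|\le1\ \forall i\}$; $\mathcal{P}(\mathcal{I}_t)=\{\mathbf{x}\in[0,1]^{\Omega_t}:\sum_a x_{(i,a)}\le1\ \forall i\}$; $\mathcal{F}_t=\{\mathbf{x}\in\mathcal{P}(\mathcal{I}_t):\sum_a x_{(i,a)}=1\ \forall i\}$. Utilities $F_t(\cdot;s):2^{\Omega_t}\to\mathbb{R}_{\ge0}$, $s\in\mathcal{S}$ (state space); $F_t(e\mid A;s)=F_t(A\cup\{e\};s)-F_t(A;s)$. Normalized: $F_t(\emptyset;s)=0$. Monotone: $F_t(A;s)\le F_t(A';s)$ if $A\subseteq A'$. Submodular: $F_t(e\mid A;s)\ge F_t(e\mid A';s)$ if $A\subseteq A'$, $e\notin A'$. Bounded marginals: there is $B<\infty$ with $0\le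 F_t(e\mid A;s)\le B$ for all $A\in\mathcal{I}_t$, $e\in\Omega_t$, $s\in\mathcal{S}$. PME: $\tilde f_t(\mathbf{x};s)=\sum_{A\in\mathcal{I}_t}F_t(A;s)\prod_{i\in\mathcal{N}_t}p_i(A;\mathbf{x})$ for $\mathbf{x}\in\mathcal{P}(\mathcal{I}_t)$, with $p_i(A;\mathbf{x})=x_{(i,a)}$ if $A\cap\Omega_{i,t}=\{(i,a)\}$ and $p_i(A;\mathbf{x})=1-\sum_{a'}x_{(i,a')}$ if $A\cap\Omega_{i,t}=\emptyset$; $\nabla$ is the gradient of this polynomial in $\mathbf{x}$. A function $f$ on a convex $\mathcal{X}\subseteq[0,1]^{\Omega_t}$ is DR-submodular if for all $\mathbf{a}\le\mathbf{b}$ in $\mathcal{X}$, every standard basis vector $\boldsymbol\chi_e$ and $k\ge0$ with $\mathbf{a}+k\boldsymbol\chi_e,\mathbf{b}+k\boldsymbol\chi_e\in\mathcal{X}$: $f(\mathbf{a}+k\boldsymbol\chi_e)-f(\mathbf{a})\ge f(\mathbf{b}+k\boldsymbol\chi_e)-f(\mathbf{b})$. Dynamics: at round $t$, given $s_t$ and $\mathbf{x}_t$, each agent $i\in\mathcal{N}_t$ independently samples $a_{i,t}$ with $\Pr(a_{i,t}=a)=(\mathbf{x}_t)_{(i,a)}$; $A_t=\{(i,a_{i,t}):i\in\mathcal{N}_t\}$; and the next state is drawn from a controlled kernel $P_t(\cdot\mid s_t,(a_{i,t})_i)$. All expectations are over the whole random trajectory (states, actions, gradient estimates), and $\mu_t^\pi$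 is the resulting law of $s_t$. Embedding: $N_{\max}=\max_t|\mathcal{N}_t|$, $N^a_{\max}=\max_{t,i}|\mathcal{A}_{i,t}|$; $\iota_t:\mathcal{F}_t\to\mathbb{R}^{N_{\max}N^a_{\max}}$ is the zero-padding embedding assigning each agent a fixed slot in $\{1,\dots,N_{\max}\}$ (distinct for simultaneously active agents) and setting all other coordinates to $0$; it preserves norms and inner products. All projections $\Pi$, distances and inner products across rounds are taken in this common Euclidean space (identifying $\mathcal{F}_t$ with $\iota_t(\mathcal{F}_t)$ and extending gradients by zero). $\mathrm{OPT}_t(s)=\max_{A\in\mathcal{I}_t}F_t(A;s)$. Dynamic $\alpha$-regret: $\mathrm{Regret}_T^{\alpha}(\pi)=\sum_{t=1}^T\big[\alpha\,\mathbb{E}_{s_t\sim\mu_t^\pi}[\mathrm{OPT}_t(s_t)]-\mathbb{E}_\pi[F_t(A_t;s_t)]\big]$. With $\mathbf{x}_t^*\in\arg\max_{\mathbf{x}\in\mathcal{F}_t}\tilde f_t(\mathbf{x};s_t)$ (a measurable selection depending on $s_t$), the path length is $\mathcal{P}_T=\mathbb{E}\big[\sum_{t=1}^{T-1}\|\iota_t(\mathbf{x}_t^* )-\iota_{t+1}(\mathbf{x}_{t+1}^* )\|_2\big]$. Also $D=\max_{t,u\in[T]}\max_{\mathbf{x}\in\iota_t(\mathcal{F}_t),\mathbf{y}\in\iota_u(\mathcal{F}_u)}\|\mathbf{x}-\mathbf{y}\|_2$, $G=\max_t\max_{\mathbf{x}\in\mathcal{F}_t}\sup_{s\in\mathcal{S}}\|\nabla\tilde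 f_t(\mathbf{x};s)\|_2$, $\sigma^2=\max_{t\in[T]}\mathbb{E}[\|\mathbf{g}_t-\nabla\tilde f_t(\mathbf{x}_t;s_t)\|_2^2]$. *)

(* Defs.v *)
From HB Require Import structures.
From mathcomp Require Import all_boot all_order all_algebra finmap.
From mathcomp Require Import all_classical all_reals all_analysis.
Set Implicit Arguments.
Unset Strict Implicit.
Unset Printing Implicit Defensive.
Import Order.TTheory GRing.Theory Num.Theory.
Import numFieldNormedType.Exports.
Local Open Scope classical_set_scope.
Local Open Scope ring_scope.

Section Euclidean.
Context {R : realType} {I : finType}.
Implicit Types (u v x y : I -> R) (X : set (I -> R)) (f : (I -> R) -> R).

Definition dot u v : R := \sum_i u i * v i.
Definition norm2 u : R := Num.sqrt (dot u u).

Definition chi (e : I) : I -> R := fun e' => (e' == e)%:R.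

(* Meant for [f] defined (as a polynomial) on all of [I -> R], so that
   two-sided partial derivatives exist also on the boundary of the domain
   of interest. *)
Definition grad f x : I -> R := fun e => derive1 (fun h : R => f (x + h *: chi e)) 0.

Definition le_coord x y : Prop := forall e, x e <= y e.

Definition nonneg_on X f : Prop := forall x, X x -> 0 <= f x.

Definition monotone_on X f : Prop :=
  forall x y, X x -> X y -> le_coord x y -> f x <= f y.

Definition dr_submodular_on X f : Prop :=
  forall a b, X a -> X b -> le_coord a b ->
  forall (e : I) (k : R), 0 <= k -> X (a + k *: chi e) -> X (b + k *: chi e) ->
  f (a + k *: chi e) - f a >= f (b + k *: chi e) - f b.

(* Nearest-point projection; the default value [z] is returned only when no
   nearest point exists, hence never for a nonempty closed convex [X]. *)
Definition proj_onto X (z : I -> R) : I -> R :=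
  xget z [set y | X y /\ forall y', X y' -> norm2 (z - y) <= norm2 (z - y')].

End Euclidean.

Section OneRound.
Context {R : realType} {N : finType} {A : N -> finType}.
Local Notation Omega := {i : N & A i}.
Implicit Types (B : {set Omega}) (F : {set Omega} -> R) (x : Omega -> R).

Definition indep B : bool := [forall i, #|[set e in B | tag e == i]| <= 1]%N.

Definition polytope : set (Omega -> R) :=
  [set x | (forall e, 0 <= x e <= 1) /\
           (forall i, \sum_(a : A i) x (Tagged A a) <= 1)].

Definition feasible : set (Omega -> R) :=
  [set x | polytope x /\ forall i, \sum_(a : A i) x (Tagged A a) = 1].

Definition normalized F : Prop := F finset.set0 = 0.

Definition monotone_set F : Prop :=
  forall B B', B \subset B' -> F B <= F B'.

Definition marginal F (e : Omega) B : R := F (e |: B)%SET - F B.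

Definition submodular F : Prop :=
  forall B B' (e : Omega), B \subset B' -> e \notin B' ->
  marginal F e B >= marginal F e B'.

Definition bounded_marginals (St : Type) (F : St -> {set Omega} -> R) : Prop :=
  exists b : R, forall B (e : Omega) (s : St), indep B ->
    0 <= marginal (F s) e B <= b.

(* On [indep B] at most one action of agent [i] lies in [B], so the [pick] is
   that action whenever there is one. *)
Definition agent_prob B x (i : N) : R :=
  if [pick a : A i | Tagged A a \in B] is Some a then x (Tagged A a)
  else 1 - \sum_(a : A i) x (Tagged A a).

Definition pme F x : R :=
  \sum_(B : {set Omega} | indep B) F B * \prod_(i : N) agent_prob B x i.

(* The empty set is independent, so [F set0] is a harmless seed. *)
Definition opt F : R := \big[Num.max/F finset.set0]_(B : {set Omega} | indep B) F B.

Definition profile : Type := {dffun forall i : N, A i}.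

Definition action_set (a : profile) : {set Omega} :=
  [set Tagged A (a i) | i : N]%SET.

Definition profile_prob x (a : profile) : R := \prod_(i : N) x (Tagged A (a i)).

End OneRound.
Arguments profile {N} A.

(* Rounds are numbered from 0: round [t] of the mathematical text is round
   [t - 1] here, and only the data of rounds [t < horizon] matter. *)
Record system (R : realType) (d : measure_display) (St : measurableType d) :=
  System {
    horizon : nat;
    agent : choiceType;
    active : nat -> {fset agent};
    act : forall t : nat, active t -> finType;
    util : forall t : nat, St -> {set {i : active t & act i}} -> R;
    trans : forall t : nat, profile (@act t) -> (R.-pker St ~> St);
    horizon_gt0 : (0 < horizon)%N;
    act_gt0 : forall (t : nat) (i : active t), (t < horizon)%N -> (0 < #|act i|)%N;
    util_ge0 : forall (t : nat) s B, (t < horizon)%N -> 0 <= util (t := t) s B }.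

Arguments act {R d St} _ t i.
Arguments util {R d St} _ t _ _.
Arguments trans {R d St} _ t _.

Section Sequential.
Context {R : realType} {d : measure_display} {St : measurableType d}.
Variable M : system R St.

Definition Omega (t : nat) : finType := {i : active M t & act M t i}.

Definition Nmax : nat := \max_(t < horizon M) #|` active M t|.
Definition Namax : nat := \max_(t < horizon M) \max_(i : active M t) #|act M t i|.

(* The slot of an agent does not depend on the round; inside the block of an
   agent, the available actions are laid out injectively. *)
Record embedding := Embedding {
  slot : agent M -> nat;
  act_slot : forall (t : nat) (i : active M t), act M t i -> nat;
  slot_lt : forall (t : nat) (i : active M t),
    (t < horizon M)%N -> (slot (val i) < Nmax)%N;
  slot_inj : forall (t : nat), (t < horizon M)%N ->
    injective (fun i : active M t => slot (val i));
  act_slot_lt : forall (t : nat) (i : active M t) (a : act M t i),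
    (t < horizon M)%N -> (act_slot a < Namax)%N;
  act_slot_inj : forall (t : nat) (i : active M t), (t < horizon M)%N ->
    injective (@act_slot t i) }.

Definition common : Type := 'I_Nmax * 'I_Namax -> R.

(* At most one term of the sum is present, by injectivity of the slots; the
   sum is empty on padding coordinates. *)
Definition embed (E : embedding) (t : nat) (x : Omega t -> R) : common :=
  fun c => \sum_(e : Omega t | (slot E (val (tag e)) == c.1) &&
                               (act_slot E (tagged e) == c.2)) x e.

Definition efeasible (E : embedding) (t : nat) : set common :=
  @embed E t @` feasible.

Definition diam (E : embedding) : R :=
  sup [set r | exists t u (x y : common),
    [/\ (t < horizon M)%N, (u < horizon M)%N, efeasible E t x, efeasible E u y &
        r = norm2 (x - y)]].

Definition grad_bound : R :=
  sup [set r | exists t (x : Omega t -> R) (s : St),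
    [/\ (t < horizon M)%N, feasible x & r = norm2 (grad (pme (util M t s)) x)]].

Definition util_measurable : Prop :=
  forall (t : nat) (B : {set Omega t}), (t < horizon M)%N ->
  measurable_fun [set: St] (fun s => util M t s B).

Definition optimal_selection (xs : forall t, St -> Omega t -> R) : Prop :=
  forall t, (t < horizon M)%N ->
  (forall e, measurable_fun [set: St] (fun s => xs t s e)) /\
  (forall s, feasible (xs t s) /\
     forall x, feasible x -> pme (util M t s) x <= pme (util M t s) (xs t s)).

End Sequential.

(* [Y] is a version of the conditional expectation of [X] given the
   sigma-algebra [H]. *)
Definition is_condexp {R : realType} {dW : measure_display}
    {W : measurableType dW} (P : probability W R) (H : set (set W))
    (X Y : W -> R) : Prop :=
  [/\ P.-integrable [set: W] (EFin \o X),
      P.-integrable [set: W] (EFin \o Y),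
      preimage_set_system [set: W] Y measurable `<=` H &
      forall K, H K ->
        (\int[P]_(w in K) (X w)%:E = \int[P]_(w in K) (Y w)%:E)%E].

Section Dynamics.
Context {R : realType} {d : measure_display} {St : measurableType d}.
Variable M : system R St.
Context {dW : measure_display} {W : measurableType dW}.
Variable P : probability W R.

Record trajectory := Trajectory {
  state : nat -> W -> St;
  marg : forall t : nat, W -> Omega M t -> R;
  play : forall t : nat, W -> profile (act M t);
  gest : forall t : nat, W -> Omega M t -> R }.

Arguments state _ t _ : clear implicits.
Arguments marg _ t _ _ : clear implicits.
Arguments play _ t _ : clear implicits.
Arguments gest _ t _ _ : clear implicits.

Variable tau : trajectory.

Definition state_events (t : nat) : set (set W) :=
  preimage_set_system [set: W] (state tau t) measurable.
Definition marg_events (t : nat) : set (set W) :=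
  \bigcup_(e : Omega M t)
    preimage_set_system [set: W] (fun w => marg tau t w e) measurable.
Definition play_events (t : nat) : set (set W) :=
  [set K | exists a, K = [set w | play tau t w = a]].

(* sigma(s_t, x_t) *)
Definition current (t : nat) : set (set W) :=
  <<s state_events t `|` marg_events t >>.

(* The history of states, marginals and actions just before, respectively just
   after, the actions of round [t] are drawn. Gradient estimates enter it only
   through the marginals they produce, so [gest tau t] may use the actions of
   round [t] or additional randomness. *)
Definition before_play (t : nat) : set (set W) :=
  <<s \bigcup_(u in `I_t.+1) (state_events u `|` marg_events u) `|`
      \bigcup_(u in `I_t) play_events u >>.
Definition after_play (t : nat) : set (set W) :=
  <<s \bigcup_(u in `I_t.+1)
        (state_events u `|` marg_events u `|` play_events u) >>.

Definition true_grad (t : nat) (w : W) : Omega M t -> R :=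
  grad (pme (util M t (state tau t w))) (marg tau t w).

Arguments true_grad : clear implicits.

Definition grad_var (t : nat) : \bar R :=
  'E_P[fun w => (norm2 (gest tau t w - true_grad t w) ^+ 2)%R]%E.

Record dynamics (E : embedding M) (eta : R) : Prop := Dynamics {
  state_meas : forall t, (t < horizon M)%N ->
    measurable_fun [set: W] (state tau t);
  marg_meas : forall t (e : Omega M t), (t < horizon M)%N ->
    measurable_fun [set: W] (fun w => marg tau t w e);
  play_meas : forall t a, (t < horizon M)%N ->
    measurable [set w | play tau t w = a];
  gest_meas : forall t (e : Omega M t), (t < horizon M)%N ->
    measurable_fun [set: W] (fun w => gest tau t w e);
  marg_feasible : forall t w, (t < horizon M)%N -> feasible (marg tau t w);
  play_law : forall t a, (t < horizon M)%N ->
    is_condexp P (before_play t) (\1_[set w | play tau t w = a])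
      (fun w => profile_prob (marg tau t w) a);
  state_law : forall t (B : set St), (t.+1 < horizon M)%N -> measurable B ->
    is_condexp P (after_play t) (\1_(state tau t.+1 @^-1` B))
      (fun w => fine (trans M t (play tau t w) (state tau t w) B));
  gest_unbiased : forall t (e : Omega M t), (t < horizon M)%N ->
    is_condexp P (current t) (fun w => gest tau t w e)
      (fun w => true_grad t w e);
  gest_var : forall t, (t < horizon M)%N -> (grad_var t < +oo)%E;
  marg_step : forall t w, (t.+1 < horizon M)%N ->
    let xbar := proj_onto (efeasible E t)
      (embed E (marg tau t w) + eta *: embed E (gest tau t w)) in
    embed E (marg tau t.+1 w) = proj_onto (efeasible E t.+1) xbar }.

(* Below, [fine] is only meant for finite expectations: variances are finite
   under [dynamics], the distances are bounded by [diam], and the utilities are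
   bounded when their marginals are. *)
Definition sigma2 : R := \big[Num.max/0]_(t < horizon M) fine (grad_var t).

Definition path_length (E : embedding M) (xs : forall t, St -> Omega M t -> R) : R :=
  fine 'E_P[fun w => (\sum_(t < (horizon M).-1)
    norm2 (embed E (xs t (state tau t w)) -
           embed E (xs t.+1 (state tau t.+1 w))))%R]%E.

Definition state_dist (t : nat) : set St -> \bar R :=
  pushforward P (state tau t).

(* A number, since both terms are already averaged over the trajectory. *)
Definition regret (alpha : R) : R :=
  \sum_(t < horizon M)
    (alpha * fine (\int[state_dist t]_s (opt (util M t s))%:E)%E
     - fine 'E_P[fun w => util M t (state tau t w) (action_set (play tau t w))]%E).

End Dynamics.
Arguments trajectory {R d St} M {dW} W.

(* Main.v *)
Require Import Defs.
From HB Require Import structures.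
From mathcomp Require Import all_boot all_order all_algebra finmap ring lra.
From mathcomp Require Import all_classical all_reals all_analysis measurable_realfun.
Set Implicit Arguments.
Unset Strict Implicit.
Unset Printing Implicit Defensive.
Import Order.TTheory GRing.Theory Num.Theory.
Import numFieldNormedType.Exports.
Local Open Scope classical_set_scope.
Local Open Scope ring_scope.

(* The extension [pme F x] is obtained from [F] by letting the agents draw their
   actions one after the other. Each draw is a positive linear operator on set
   functions; these operators commute with one another and with the discrete
   derivatives [marginal _ e], so the signs of the first and second discrete
   derivatives of [F] pass to the partial derivatives of [pme F]. Hence
   <grad f x, y> >= f y - f x, while <grad f x, x> <= f x by telescoping over
   the agents, which gives the half-gradient inequality.

   Full profiles are the vertices of the feasible set, so OPT is at most the
   value of the best feasible point, and the regret is at most half of the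
   expected linear regret of the iterates against these points. The true
   gradients may be replaced by their estimates there, since the comparators and
   iterates are measurable with respect to the conditioning sigma-algebra. What
   remains is projected online gradient ascent with a moving comparator: the
   projection onto the next feasible set brings the iterate closer to the next
   comparator, and moving the comparator by [r] costs at most [2 D r]. *)

(** * The one-round extension *)

Section PME.
Context {R : realType} {N : finType} {A : N -> finType}.
Local Notation Omega := {i : N & A i}.
Implicit Types (B S : {set Omega}) (F G : {set Omega} -> R) (x y : Omega -> R).
Implicit Types (e : Omega) (i j : N) (l : seq N).

(* The expected value of [F] after agent [i] draws an action from [x], or no
   action with the missing probability, and adds it to the given set. *)
Definition mix x i F : {set Omega} -> R :=
  fun S => F S + \sum_(a : A i) x (Tagged A a) * marginal F (Tagged A a) S.

Definition mixs x l F : {set Omega} -> R := foldr (mix x) F l.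

Lemma mixE x i F S :
  mix x i F S = (1 - \sum_(a : A i) x (Tagged A a)) * F S +
    \sum_(a : A i) x (Tagged A a) * F (Tagged A a |: S)%SET.
Proof.
rewrite /mix mulrBl mul1r -addrA; congr (_ + _).
rewrite mulr_suml -sumrN -big_split; apply: eq_bigr => a _ /=.
by rewrite /marginal mulrBr addrC.
Qed.

Lemma marginalC F e e' : marginal (marginal F e) e' = marginal (marginal F e') e.
Proof. by apply/funext => S; rewrite /marginal finset.setUCA; ring. Qed.

Lemma marginal_mix x i F e : marginal (mix x i F) e = mix x i (marginal F e).
Proof.
apply/funext => S; rewrite {1}/marginal /mix opprD addrACA; congr (_ + _).
rewrite -sumrB; apply: eq_bigr => a _.
by rewrite -mulrBr marginalC.
Qed.

Lemma marginal_mixs x l F e : marginal (mixs x l F) e = mixs x l (marginal F e).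
Proof. by elim: l => //= i l IH; rewrite marginal_mix IH. Qed.

(** Both sides expand to [F S], the two first-order sums, and a double sum of second discrete
    derivatives that is symmetric by [marginalC]. *)
Lemma mixC x i j F : mix x i (mix x j F) = mix x j (mix x i F).
Proof.
apply/funext => S; rewrite /(mix x i) /(mix x j) -!addrA; congr (_ + _).
under [X in _ + X]eq_bigr do rewrite marginal_mix mulrDr.
under [X in _ = _ + X]eq_bigr do rewrite marginal_mix mulrDr.
rewrite !big_split /= addrCA; congr (_ + (_ + _)).
under eq_bigr do rewrite mulr_sumr.
rewrite exchange_big /=; apply: eq_bigr => a _.
rewrite mulr_sumr; apply: eq_bigr => b _.
by rewrite marginalC mulrCA.
Qed.

Lemma mixs_rem x l i F : i \in l -> mixs x l F = mix x i (mixs x (rem i l) F).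
Proof.
elim: l => //= j l IH; rewrite inE; case: eqVneq => [->|ij] /=; first by [].
by move=> il; rewrite IH // mixC.
Qed.

Lemma mixN x i F : mix x i (\- F) = \- mix x i F.
Proof.
apply/funext => S; rewrite /mix /= opprD -sumrN; congr (_ + _).
by apply: eq_bigr => a _; rewrite /marginal /=; ring.
Qed.

Lemma mixsN x l F : mixs x l (\- F) = \- mixs x l F.
Proof. by elim: l => //= i l ->; rewrite mixN. Qed.

Lemma mixs0 l F : mixs 0 l F = F.
Proof.
elim: l => //= i l ->; apply/funext => S.
by rewrite /mix big1 ?addr0 // => a _; rewrite mul0r.
Qed.

Lemma mixs_agree x y l F :
  (forall e, tag e \in l -> x e = y e) -> mixs x l F = mixs y l F.
Proof.
elim: l => //= i l IH xy.
rewrite IH => [|e el]; last by apply: xy; rewrite inE el orbT.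
apply/funext => S; rewrite /mix; congr (_ + _); apply: eq_bigr => a _.
by rewrite xy // inE eqxx.
Qed.

(** On the polytope the weights in [mixE] are nonnegative, so a draw is a positive operator. *)
Lemma mix_le x i F G S : polytope x ->
  (forall B, F B <= G B) -> mix x i F S <= mix x i G S.
Proof.
move=> [x01 x1] FG; rewrite !mixE; apply: lerD.
  by apply: ler_wpM2l; rewrite // subr_ge0.
apply: ler_sum => a _; apply: ler_wpM2l => //.
by have /andP[] := x01 (Tagged A a).
Qed.

Lemma mix_ge0 x i F S : polytope x -> (forall B, 0 <= F B) -> 0 <= mix x i F S.
Proof.
move=> px F0; have := mix_le i S px F0; apply: le_trans.
by rewrite /mix big1 ?addr0 // => a _; rewrite /marginal subrr mulr0.
Qed.

Lemma mixs_ge0 x l F S : polytope x -> (forall B, 0 <= F B) -> 0 <= mixs x l F S.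
Proof. by move=> px F0; elim: l S => //= i l IH S; exact: mix_ge0. Qed.

Lemma mixs_le x l F G S : polytope x ->
  (forall B, F B <= G B) -> mixs x l F S <= mixs x l G S.
Proof. by move=> px FG; elim: l S => //= i l IH S; exact: mix_le. Qed.

(** One agent at a time: positivity of its draw replaces [x] by [y] for the agents further in, and
    its own weights may then grow because the marginals of [mixs y l F] are again nonnegative. *)
Lemma mixs_mono x y l F S : polytope x -> polytope y -> le_coord x y ->
  (forall e B, 0 <= marginal F e B) -> mixs x l F S <= mixs y l F S.
Proof.
move=> px py xy F0; elim: l S => //= i l IH S.
apply: (@le_trans _ _ (mix x i (mixs y l F) S)); first exact: mix_le.
rewrite lerD2l; apply: ler_sum => a _; apply: ler_wpM2r => //.
by rewrite marginal_mixs; exact: mixs_ge0.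
Qed.

Lemma mixs_anti x y l F S : polytope x -> polytope y -> le_coord x y ->
  (forall e B, marginal F e B <= 0) -> mixs y l F S <= mixs x l F S.
Proof.
move=> px py xy F0; rewrite -lerN2.
have := @mixs_mono x y l (\- F) S px py xy; rewrite !mixsN; apply => e B.
by have := F0 e B; rewrite /marginal /=; lra.
Qed.

Lemma polytope0 : polytope (0 : Omega -> R).
Proof.
by split=> [e|i]; rewrite ?lexx ?ler01 // big1.
Qed.

(** Comparison with the zero vector, at which every draw is the identity. *)
Lemma mixs_le_id x l F S : polytope x ->
  (forall e B, marginal F e B <= 0) -> mixs x l F S <= F S.
Proof.
move=> px F0; rewrite -{2}(mixs0 l F); apply: mixs_anti => //; first exact: polytope0.
by move=> e; have [/(_ e)/andP[]] := px.
Qed.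

(** * Iterated draws as a polynomial, and its partial derivatives *)

Definition avoids l S := [forall e in S, tag e \notin l].

Lemma indepP B : reflect (forall e e', e \in B -> e' \in B -> tag e = tag e' -> e = e')
  (indep B).
Proof.
apply: (iffP forallP) => [iB e e' eB e'B tee'|uB i].
  have /card_le1_eqP := iB (tag e); apply; rewrite !inE ?eB ?e'B ?eqxx //=.
  by rewrite tee'.
apply/card_le1_eqP => e e'; rewrite !inE => /andP[eB /eqP ei] /andP[e'B /eqP e'i].
by apply: uB => //; rewrite ei e'i.
Qed.

Lemma tag_inhab e i : tag e = i -> exists a : A i, e = Tagged A a.
Proof. by case: e => j a /= <-; exists a. Qed.

Lemma mix_lsum (J : finType) (c : J -> R) (G : J -> {set Omega} -> R) x i S :
  mix x i (fun B => \sum_j c j * G j B) S = \sum_j c j * mix x i (G j) S.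
Proof.
rewrite /mix; under [RHS]eq_bigr do rewrite mulrDr mulr_sumr.
rewrite big_split /=; congr (_ + _); rewrite exchange_big /=.
apply: eq_bigr => a _; rewrite /marginal -sumrB mulr_sumr.
by apply: eq_bigr => j _; rewrite -mulrBr mulrCA.
Qed.

Lemma mixs_lsum (J : finType) (c : J -> R) (G : J -> {set Omega} -> R) x l S :
  mixs x l (fun B => \sum_j c j * G j B) S = \sum_j c j * mixs x l (G j) S.
Proof.
elim: l S => //= i l IH S; rewrite -mix_lsum; congr (mix x i _ S).
exact/funext.
Qed.

Lemma mix_subl (c : R) x i F S : mix x i (fun B => c - F B) S = c - mix x i F S.
Proof.
rewrite /mix opprD addrA -sumrN; congr (_ + _).
by apply: eq_bigr => a _; rewrite /marginal; ring.
Qed.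

Lemma mixs_subl (c : R) x l F S :
  mixs x l (fun B => c - F B) S = c - mixs x l F S.
Proof.
elim: l S => //= i l IH S; rewrite -mix_subl; congr (mix x i _ S).
exact/funext.
Qed.

(* Splitting the sum on the action of the first agent turns one application of
   [mix] into the choice of that agent. *)
Lemma mixs_sum x l F S : uniq l -> indep S -> avoids l S ->
  mixs x l F S = \sum_(B | indep B && ([set e in B | tag e \notin l]%SET == S))
     F B * \prod_(i <- l) agent_prob B x i.
Proof.
elim: l S => [|i l IH] S /=.
  move=> _ iS _; rewrite (big_pred1 S) ?big_nil ?mulr1 // => B.
  have -> : [set e in B | tag e \notin [::]]%SET = B.
    by apply/setP => e; rewrite inE andbT.
  by rewrite /= andbC; case: eqVneq => // ->; rewrite iS.
move=> /andP[il ul] iS /forall_inP aS.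
have aSi e : e \in S -> tag e != i.
  by move/aS; rewrite inE negb_or => /andP[].
have aSl : avoids l S.
  by apply/forall_inP => e /aS; rewrite inE negb_or => /andP[].
have iSa (a : A i) : indep (Tagged A a |: S)%SET.
  apply/indepP => e e'; rewrite !inE => /orP[/eqP->|eS] /orP[/eqP->|e'S] //=.
  - by move=> h; have := aSi _ e'S; rewrite -h eqxx.
  - by move=> h; have := aSi _ eS; rewrite h eqxx.
  - by move/indepP: iS; apply.
have aSa (a : A i) : avoids l (Tagged A a |: S)%SET.
  apply/forall_inP => e; rewrite !inE => /orP[/eqP->//|].
  by move: e; apply/forall_inP.
rewrite mixE IH //.
under [X in _ + X = _]eq_bigr do rewrite IH //.
(* [None] collects the sets without an action of agent [i], and [Some a] those containing [a]; these
   match the two parts of [mixE]. *)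
rewrite [RHS](partition_big (fun B => [pick a : A i | Tagged A a \in B]) predT) //=.
rewrite (bigD1 None) //= [X in _ = _ + X](reindex_omap Some id) /=; last by case.
congr (_ + _).
  rewrite mulr_sumr; apply: eq_big => [B|B].
    rewrite -andbA; case: (boolP (indep B)) => //= iB.
    case: pickP => [a aB|nB].
      rewrite andbF; apply/negbTE/eqP => BS.
      have : Tagged A a \in S by rewrite -BS inE aB.
      by move/aSi; rewrite eqxx.
    rewrite andbT; congr (_ == _); apply/setP => e; rewrite !inE.
    case eB: (e \in B) => //=; case: eqVneq => //= ei.
    by have [b eb] := tag_inhab ei; rewrite eb nB in eB.
  move=> /andP[iB /eqP BS]; rewrite big_cons mulrCA; congr (_ * _).
  rewrite /agent_prob; case: pickP => // a aB.
  have : Tagged A a \in S by rewrite -BS inE aB.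
  by move/aSi; rewrite eqxx.
apply: eq_big => [a|a _]; first by rewrite eqxx.
rewrite mulr_sumr; apply: eq_big => [B|B].
  rewrite -andbA; case: (boolP (indep B)) => //= /indepP iB.
  apply/eqP/andP => [BS|[/eqP BS]].
    have aB : Tagged A a \in B.
      by have := setU11 (Tagged A a) S; rewrite -BS inE => /andP[].
    split; last first.
      case: pickP => [b bB|/(_ a)]; last by rewrite aB.
      by have /eqP := iB _ _ bB aB erefl; rewrite -tag_eqE /tag_eq eqxx /= tagged_asE => /eqP ->.
    apply/eqP/setP => e; move/setP/(_ e): BS; rewrite !inE.
    case eB: (e \in B) => /=; last first.
      by case: (e \in S); rewrite ?orbT // orbF => _.
    case: (eqVneq (tag e) i) => [ei|ni] /=.
      by move=> _; apply/esym/negbTE; apply/negP => /aSi; rewrite ei eqxx.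
    by move->; case: eqVneq => //= ea; move: ni; rewrite ea eqxx.
  case: pickP => // b bB /eqP[ba]; rewrite {b}ba in bB.
  apply/setP => e; move/setP/(_ e): BS; rewrite !inE.
  case eB: (e \in B) => /= BS; last first.
    by rewrite -BS orbF; apply/esym/negbTE/eqP => ea; rewrite ea bB in eB.
  case: (eqVneq (tag e) i) BS => [ei|ni] /= <-; last first.
    by case: eqVneq => //= ea; move: ni; rewrite ea eqxx.
  by rewrite ei il orbF (iB _ _ eB bB ei) eqxx.
move=> /andP[/indepP iB /eqP BS]; rewrite big_cons mulrCA; congr (_ * (_ * _)).
have aB : Tagged A a \in B.
  by have := setU11 (Tagged A a) S; rewrite -BS inE => /andP[].
rewrite /agent_prob; case: pickP => [b bB|/(_ a)]; last by rewrite aB.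
by rewrite (iB _ _ bB aB).
Qed.

Lemma pmeE F x : pme F x = mixs x (enum N) F finset.set0.
Proof.
rewrite mixs_sum ?enum_uniq //; first last.
- by apply/forall_inP => e; rewrite inE.
- by apply/indepP => e e'; rewrite inE.
rewrite /pme; apply: eq_big => [B|B _]; last by rewrite big_enum.
case: (indep B) => //=; apply/esym/eqP/setP => e.
by rewrite !inE mem_enum andbF.
Qed.

(** The expected marginal of [e] once every agent other than its own has drawn. Since [pme F] is
    affine in the coordinates of one agent, this is its partial derivative along [e]. *)
Definition pderiv F x e : R := mixs x (rem (tag e) (enum N)) (marginal F e) finset.set0.

(** By commutation the draw of the agent of [e] can be moved to the outside. The remaining draws do
    not read the coordinate [e], so the dependence on [k] is affine. *)
Lemma mixs_shift x k e F :
  mixs (x + k *: chi e) (enum N) F finset.set0 =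
  mixs x (enum N) F finset.set0 + k * pderiv F x e.
Proof.
have ein : tag e \in enum N by rewrite mem_enum.
rewrite !(mixs_rem _ _ ein) (@mixs_agree (x + k *: chi e) x); last first.
  move=> e'; rewrite mem_rem_uniq ?enum_uniq // !inE => /andP[ne _].
  rewrite [LHS](_ : _ = x e' + k * (e' == e)%:R) //.
  case: eqVneq => [ee'|]; last by rewrite mulr0 addr0.
  by rewrite ee' eqxx in ne.
rewrite /mix -addrA; congr (_ + _).
rewrite /pderiv -marginal_mixs; case: e ein => i b /= _.
rewrite [X in _ = _ + k * X](_ : _ = \sum_(a : A i) (a == b)%:R *
  marginal (mixs x (rem i (enum N)) F) (Tagged A a) finset.set0); last first.
  rewrite (bigD1 b) //= eqxx mul1r big1 ?addr0 // => a /negbTE ->.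
  by rewrite mul0r.
rewrite mulr_sumr -big_split /=; apply: eq_bigr => a _.
rewrite [X in X * _](_ : _ = x (Tagged A a) + k * (Tagged A a == Tagged A b)%:R) //.
by rewrite eq_Tagged mulrDl mulrA.
Qed.

Lemma pme_shift F x k e : pme F (x + k *: chi e) = pme F x + k * pderiv F x e.
Proof. by rewrite !pmeE mixs_shift. Qed.

Lemma gradE F x e : grad (pme F) x e = pderiv F x e.
Proof.
rewrite /grad; under eq_fun do rewrite pme_shift.
rewrite derive1E deriveD// derive_cst add0r deriveMr// derive_id.
by rewrite /GRing.scale /= mulr1.
Qed.

(** * Consequences of monotonicity and submodularity *)

Section Submodular.
Variable F : {set Omega} -> R.
Hypotheses (F0 : forall B, 0 <= F B) (Fmon : monotone_set F) (Fsub : submodular F).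

Lemma marginal_ge0 e S : 0 <= marginal F e S.
Proof. by rewrite subr_ge0; apply: Fmon; exact: finset.subsetUr. Qed.

(** Submodularity covers the case where [e] is new to the larger set. Otherwise the marginal at the
    larger set vanishes, and the one at [S] is nonnegative by monotonicity. *)
Lemma marginal2_le0 e e' S : marginal (marginal F e) e' S <= 0.
Proof.
rewrite {1}/marginal subr_le0; case: (boolP (e \in e' |: S)%SET) => [eS|eS].
  rewrite [leLHS]/marginal (_ : (e |: (e' |: S) = e' |: S)%SET) ?subrr ?marginal_ge0 //.
  by apply/finset.setUidPr; rewrite finset.sub1set.
by apply: Fsub => //; exact: finset.subsetUr.
Qed.

Lemma mixs_subset x l S S' : polytope x -> S \subset S' ->
  mixs x l F S <= mixs x l F S'.
Proof.
move=> px; elim: l S S' => [|i l IH] S S' SS' /=; first exact: Fmon.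
have [x01 x1] := px; rewrite !mixE; apply: lerD.
  by apply: ler_wpM2l; rewrite ?subr_ge0 // IH.
apply: ler_sum => a _; apply: ler_wpM2l; first by have /andP[] := x01 (Tagged A a).
by apply: IH; exact: finset.setUS.
Qed.

Lemma pderiv_ge0 x e : polytope x -> 0 <= pderiv F x e.
Proof. by move=> px; apply: mixs_ge0 => // B; exact: marginal_ge0. Qed.

(** Further draws only lower a marginal, by diminishing returns; this bounds the gradient uniformly
    in [x]. *)
Lemma pderiv_le x e : polytope x -> pderiv F x e <= marginal F e finset.set0.
Proof. by move=> px; apply: mixs_le_id => // e' B; exact: marginal2_le0. Qed.

Lemma pme_nonneg : nonneg_on polytope (pme F).
Proof. by move=> x px; rewrite pmeE; exact: mixs_ge0. Qed.

Lemma pme_monotone : monotone_on polytope (pme F).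
Proof. by move=> x y px py xy; rewrite !pmeE; apply: mixs_mono => //; exact: marginal_ge0. Qed.

Lemma pme_dr : dr_submodular_on polytope (pme F).
Proof.
move=> a b pa pb ab e k k0 _ _; rewrite !pme_shift ![_ + _ - _]addrAC !subrr !add0r.
by apply: ler_wpM2l => //; apply: mixs_anti => // e' B; exact: marginal2_le0.
Qed.

(** Telescoping over the draws: each increment averages marginals taken after earlier draws, and
    these are at most the marginals at [S] itself. *)
Lemma mixs_sub_le y l S : polytope y ->
  mixs y l F S - F S <=
  \sum_(i <- l) \sum_(a : A i) y (Tagged A a) * marginal F (Tagged A a) S.
Proof.
move=> py; elim: l => [|i l IH] /=; first by rewrite big_nil subrr.
rewrite big_cons [X in X - _]/mix addrAC addrC; apply: lerD => //.
apply: ler_sum => a _; apply: ler_wpM2l; first by have [/(_ (Tagged A a))/andP[]] := py.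
by rewrite marginal_mixs; apply: mixs_le_id => // e' B; exact: marginal2_le0.
Qed.

Lemma dot_pderiv x y :
  dot (pderiv F x) y = \sum_i \sum_(a : A i) y (Tagged A a) * pderiv F x (Tagged A a).
Proof.
rewrite (sig_big_dep xpredT (fun=> xpredT)
  (fun i (a : A i) => y (Tagged A a) * pderiv F x (Tagged A a))) /=.
by apply: eq_bigr => -[i a] _; rewrite mulrC.
Qed.

(** For each set [B], adding draws from [y] to [B] is worth at least [pme F y], and at most [F B]
    plus the [y]-weighted marginals at [B]. The inequality is then averaged over [B] drawn from
    [x]. *)
Lemma pme_sub_le_dot x y : polytope x -> polytope y ->
  pme F y - pme F x <= dot (pderiv F x) y.
Proof.
move=> px py; set f := pme F.
apply: (@le_trans _ _ (\sum_(e : Omega) y e * mixs x (enum N) (marginal F e) finset.set0)).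
  rewrite -(@mixs_lsum _ y (marginal F)) [f x]pmeE.
  have -> : f y - mixs x (enum N) F finset.set0 =
      mixs x (enum N) (fun B => f y - F B) finset.set0.
    by rewrite mixs_subl.
  apply: mixs_le => // B.
  apply: (@le_trans _ _ (mixs y (enum N) F B - F B)).
    by rewrite lerD2r /f pmeE; apply: mixs_subset => //; exact: finset.sub0set.
  apply: (le_trans (mixs_sub_le _ _ py)).
  rewrite big_enum /= (sig_big_dep xpredT (fun=> xpredT)
    (fun i (a : A i) => y (Tagged A a) * marginal F (Tagged A a) B)) /=.
  by apply: ler_sum => -[i a] _.
(* Here the agent of [e] has drawn as well; undoing its draw can only raise the expected marginal,
   which becomes [pderiv F x e]. *)
apply: ler_sum => e _; rewrite mulrC; apply: ler_wpM2r; first by have [/(_ e)/andP[]] := py.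
have ein : tag e \in enum N by rewrite mem_enum.
rewrite (mixs_rem _ _ ein); apply: (@mixs_le_id _ [:: tag e]) => // e' B.
rewrite marginal_mixs -oppr_ge0.
have := @mixs_ge0 x (rem (tag e) (enum N)) (\- marginal (marginal F e) e') B px.
by rewrite mixsN; apply => C; rewrite /= oppr_ge0 marginal2_le0.
Qed.

(** The increment due to the outermost agent [j] is exactly its own term. In the terms of the other
    agents, letting [j] draw as well only lowers the marginals, so they are at most those of the
    induction hypothesis. *)
Lemma sum_pderiv_le x l S : uniq l -> polytope x ->
  \sum_(i <- l) \sum_(a : A i) x (Tagged A a) *
     mixs x (rem i l) (marginal F (Tagged A a)) S <= mixs x l F S - F S.
Proof.
move=> + px; elim: l => [|j l IH] /=; first by rewrite big_nil subrr.
move=> /andP[jl ul]; rewrite big_cons /= eqxx [X in _ <= X - _]/mix addrAC addrC.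
apply: lerD.
  by apply: ler_sum => a _; rewrite marginal_mixs.
apply: le_trans (IH ul); rewrite !big_seq; apply: ler_sum => i il.
have /negbTE -> : j != i by apply: contraNneq jl => ->.
apply: ler_sum => a _; apply: ler_wpM2l; first by have [/(_ (Tagged A a))/andP[]] := px.
apply: (@mixs_le_id _ [:: j]) => // e' B.
rewrite marginal_mixs -oppr_ge0.
have := @mixs_ge0 x (rem i l) (\- marginal (marginal F (Tagged A a)) e') B px.
by rewrite mixsN; apply => C; rewrite /= oppr_ge0 marginal2_le0.
Qed.

Lemma dot_pderiv_self_le x : polytope x -> dot (pderiv F x) x <= pme F x.
Proof.
move=> px; rewrite dot_pderiv pmeE.
have := @sum_pderiv_le x (enum N) finset.set0 (enum_uniq _) px.
rewrite big_enum => /le_trans; apply.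
by rewrite lerBlDr lerDl.
Qed.

(** The two preceding bounds combine into: the gradient at [x] paired with [y - x] is at least
    [pme F y - 2 * pme F x]. *)
Lemma pme_half x y : polytope x -> polytope y ->
  1 / 2 * pme F y - pme F x <= 1 / 2 * dot (grad (pme F) x) (y - x).
Proof.
move=> px py; rewrite (_ : grad _ x = pderiv F x); last by apply/funext => e; exact: gradE.
have := pme_sub_le_dot px py; have := dot_pderiv_self_le px.
have -> : dot (pderiv F x) (y - x) = dot (pderiv F x) y - dot (pderiv F x) x.
  by rewrite /dot -sumrB; apply: eq_bigr => e _; rewrite mulrBr.
lra.
Qed.

End Submodular.

(** * Profiles as vertices of the feasible set *)

Lemma action_setP (c : profile A) i (a : A i) : (Tagged A a \in action_set c) = (c i == a).
Proof.
apply/imsetP/eqP => [[j _ ja]|<-]; last by exists i.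
have ji : j = i by have := congr1 tag ja.
by case: i / ji a ja => a /eqP; rewrite eq_Tagged /= => /eqP ->.
Qed.

Lemma action_set_indep (c : profile A) : indep (action_set c).
Proof.
apply/indepP => e e' /imsetP[i _ ->] /imsetP[j _ ->] /= ij.
by case: j / ij.
Qed.

Lemma agent_prob_action (c : profile A) x i :
  agent_prob (action_set c) x i = x (Tagged A (c i)).
Proof.
rewrite /agent_prob; case: pickP => [a|/(_ (c i))]; rewrite action_setP ?eqxx //.
by move=> /eqP <-.
Qed.

(** At a feasible point every agent acts almost surely: a set missing some agent has probability
    zero, and any other independent set is the action set of exactly one profile. *)
Lemma pme_profile F x : feasible x ->
  pme F x = \sum_(c : profile A) profile_prob x c * F (action_set c).
Proof.
move=> [_ x1]; rewrite /pme.
transitivity (\sum_(B | indep B) \sum_(c : profile A | action_set c == B)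
    profile_prob x c * F (action_set c)); last first.
  rewrite (exchange_big_dep xpredT) //=; apply: eq_bigr => c _.
  rewrite (big_pred1 (action_set c)) // => B.
  by rewrite /= eq_sym; case: eqVneq => [->|]; rewrite ?action_set_indep ?andbF ?andbT.
apply: eq_bigr => B /indepP iB.
have [full|] := boolP [forall i, [exists a : A i, Tagged A a \in B]].
  have pk i : {a : A i | Tagged A a \in B}.
    by apply: sigW; have /forallP/(_ i)/existsP := full.
  pose c : profile A := [ffun i => sval (pk i)].
  have cB : action_set c = B.
    apply/setP => -[i a]; apply/idP/idP => [/imsetP[j _ ->]|aB].
      by rewrite ffunE; exact: svalP (pk j).
    rewrite -[existT _ i a]/(Tagged A a) action_setP ffunE.
    by have /eqP := iB _ _ aB (svalP (pk i)) erefl; rewrite eq_Tagged /= eq_sym.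
  rewrite (big_pred1 c) => [|c' /=].
    rewrite cB mulrC; congr (_ * _); rewrite -cB.
    by apply: eq_bigr => i _; rewrite agent_prob_action.
  apply/eqP/eqP => [c'B|-> //]; apply/ffunP => i; apply/eqP.
  by rewrite -action_setP c'B -cB action_setP.
rewrite negb_forall => /existsP[i]; rewrite negb_exists => /forallP nB.
rewrite [RHS]big_pred0 => [|c]; last first.
  apply/negbTE; apply/negP => /eqP cB; have /negP := nB (c i).
  by rewrite -cB action_setP eqxx; apply.
rewrite (bigD1 i) //= {1}/agent_prob; case: pickP => [a aB|_].
  by move: (nB a); rewrite aB.
by rewrite x1 subrr mul0r mulr0.
Qed.

Lemma pure_feasible (c : profile A) : feasible (fun e => (e \in action_set c)%:R : R).
Proof.
have s1 i : \sum_(a : A i) (Tagged A a \in action_set c)%:R = 1 :> R.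
  rewrite (bigD1 (c i)) //= action_setP eqxx big1 ?addr0 // => a /negbTE ca.
  by rewrite action_setP eq_sym ca.
split=> //; split=> [e|i]; last by rewrite s1.
by case: (_ \in _); rewrite ?lexx ?ler01.
Qed.

Lemma pme_pure F (c : profile A) :
  pme F (fun e => (e \in action_set c)%:R) = F (action_set c).
Proof.
rewrite pme_profile; last exact: pure_feasible.
rewrite (bigD1 c) //= {1}/profile_prob big1 => [|i _]; last by rewrite action_setP eqxx.
rewrite mul1r big1 ?addr0 // => c' c'c.
have [i ci] : exists i, c' i != c i.
  apply/existsP; rewrite -negb_forall; apply: contraNN c'c => /forallP h.
  by apply/eqP/ffunP => i; apply/eqP.
by rewrite /profile_prob (bigD1 i) //= action_setP eq_sym (negbTE ci) !mul0r.
Qed.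

(** An independent set extends to a full profile, at no loss by monotonicity, and the value of a
    profile is the value of [pme F] at a vertex. *)
Lemma opt_le F (m : R) : (forall i, (0 < #|A i|)%N) -> monotone_set F ->
  (forall x, feasible x -> pme F x <= m) -> opt F <= m.
Proof.
move=> A0 Fmon fm.
suff h B : indep B -> F B <= m.
  rewrite /opt; apply: (big_ind (fun r => r <= m)) => //.
    by apply: h; apply/indepP => e e'; rewrite inE.
  by move=> r r' rm r'm; rewrite ge_max rm.
move=> /indepP iB.
(* Agent [i] keeps its action in [B] if it has one, and takes an arbitrary action otherwise. *)
have pk i : {a : A i | forall b, Tagged A b \in B -> b = a}.
  apply: cid; case: (pickP (fun a : A i => Tagged A a \in B)) => [a aB|nB].
    exists a => b bB; have /eqP := iB _ _ bB aB erefl.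
    by rewrite eq_Tagged /= => /eqP.
  by have /card_gt0P[a _] := A0 i; exists a => b; rewrite nB.
pose c : profile A := [ffun i => sval (pk i)].
apply: le_trans (fm _ (pure_feasible c)); rewrite pme_pure.
apply: Fmon; apply/fintype.subsetP => -[i a] aB.
rewrite -[existT _ i a]/(Tagged A a) action_setP ffunE eq_sym.
by apply/eqP; exact: (svalP (pk i)).
Qed.

End PME.

(** * Projections and online gradient ascent *)

Section Geometry.
Context {R : realType} {I : finType}.
Implicit Types (u v w x y z : I -> R) (X : set (I -> R)) (a : R).

Lemma dotC u v : dot u v = dot v u.
Proof. by apply: eq_bigr => i _; rewrite mulrC. Qed.

Lemma dotDl u v w : dot (u + v) w = dot u w + dot v w.
Proof. by rewrite /dot -big_split; apply: eq_bigr => i _; rewrite /= mulrDl. Qed.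

Lemma dotZl a u v : dot (a *: u) v = a * dot u v.
Proof. by rewrite /dot mulr_sumr; apply: eq_bigr => i _; rewrite mulrA. Qed.

Lemma dotNl u v : dot (- u) v = - dot u v.
Proof. by rewrite -scaleN1r dotZl mulN1r. Qed.

Lemma dotDr u v w : dot w (u + v) = dot w u + dot w v.
Proof. by rewrite dotC dotDl !(dotC w). Qed.

Lemma dotZr a u v : dot v (a *: u) = a * dot v u.
Proof. by rewrite dotC dotZl dotC. Qed.

Lemma dotNr u v : dot u (- v) = - dot u v.
Proof. by rewrite dotC dotNl dotC. Qed.

Definition dotE := (dotDl, dotDr, dotNl, dotNr, dotZl, dotZr).

Lemma dot_sub u v : dot (u - v) (u - v) = dot u u - 2 * dot u v + dot v v.
Proof. by rewrite !dotE (dotC v u); ring. Qed.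

Lemma dot_ge0 u : 0 <= dot u u.
Proof. by apply: sumr_ge0 => i _; rewrite -expr2 sqr_ge0. Qed.

Lemma norm2_ge0 u : 0 <= norm2 u.
Proof. exact: sqrtr_ge0. Qed.

Lemma norm2_sqr u : norm2 u ^+ 2 = dot u u.
Proof. by rewrite sqr_sqrtr // dot_ge0. Qed.

Lemma norm2_leP u v : (norm2 u <= norm2 v) = (dot u u <= dot v v).
Proof. by rewrite ler_sqrt // dot_ge0. Qed.

Lemma norm2_le u a : 0 <= a -> dot u u <= a ^+ 2 -> norm2 u <= a.
Proof. by move=> a0 ua; rewrite -(@ler_pXn2r _ 2) ?nnegrE ?norm2_ge0 ?norm2_sqr. Qed.

Lemma cauchy_schwarz u v : dot u v <= norm2 u * norm2 v.
Proof.
have [v0|vpos] := eqVneq (dot v v) 0.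
  have v0i i : v i = 0.
    have vj j : true -> 0 <= v j * v j by rewrite -expr2 sqr_ge0.
    by have /(_ i erefl)/eqP := psumr_eq0P vj v0; rewrite mulf_eq0 orbb => /eqP.
  rewrite /dot big1 ?mulr_ge0 ?norm2_ge0 // => i _; by rewrite v0i mulr0.
rewrite (le_trans (ler_norm _)) // -(@ler_pXn2r _ 2) ?nnegrE ?mulr_ge0 ?norm2_ge0 //.
rewrite exprMn !norm2_sqr real_normK ?num_real //.
have dv : 0 < dot v v by rewrite lt_def vpos dot_ge0.
have := dot_ge0 (dot v v *: u - dot u v *: v); rewrite !dotE (dotC v u) => h.
have : 0 <= dot v v * (dot u u * dot v v - dot u v ^+ 2) by nra.
by rewrite pmulr_rge0 // subr_ge0.
Qed.

Lemma norm2_triangle u v : norm2 (u + v) <= norm2 u + norm2 v.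
Proof.
apply: norm2_le; first by rewrite addr_ge0 ?norm2_ge0.
by rewrite !dotE (dotC v u); have := cauchy_schwarz u v; rewrite -!norm2_sqr; nra.
Qed.

Lemma norm2_sub_triangle u v w : norm2 (u - w) <= norm2 (u - v) + norm2 (v - w).
Proof. by have := norm2_triangle (u - v) (v - w); rewrite addrA subrK. Qed.

(** The condition under which [proj_onto] never falls back on its default value. *)
Definition has_nearest X :=
  forall z, exists2 p, X p & forall y, X y -> norm2 (z - p) <= norm2 (z - y).

Definition convex X := forall x y a, X x -> X y -> 0 <= a -> a <= 1 -> X (x + a *: (y - x)).

Lemma proj_ontoP X z : has_nearest X ->
  X (proj_onto X z) /\ forall y, X y -> norm2 (z - proj_onto X z) <= norm2 (z - y).
Proof.
move=> hX; rewrite /proj_onto.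
case: xgetP => [y _ //|noy].
by have [p Xp hp] := hX z; case: (noy p).
Qed.

(** The vectors from the projection [p] to [z] and to [y] do not form an acute angle, that is
    [c <= 0]; expanding the squared distance from [z] to [y] around [p] then gives the claim. *)
Lemma proj_onto_contract X z y : has_nearest X -> convex X -> X y ->
  norm2 (proj_onto X z - y) <= norm2 (z - y).
Proof.
move=> hX cX Xy; have [] := proj_ontoP z hX; set p := proj_onto X z => Xp pmin.
set c := dot (z - p) (y - p); set Q := dot (y - p) (y - p).
have Q0 : 0 <= Q := dot_ge0 _.
suff c0 : c <= 0.
  rewrite norm2_leP (_ : z - y = (z - p) - (y - p)); last by rewrite opprB addrA subrK.
  rewrite -[p - y]opprB dotNl dotNr opprK (dot_sub (z - p)) -/c -/Q.
  by have := dot_ge0 (z - p); lra.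
rewrite leNgt; apply/negP => c0.
(* If [c] were positive, moving from [p] towards [y] by the fraction [l] would change the squared
   distance to [z] by [l * (l * Q - 2 * c)], which is negative since [l * Q < c]. *)
pose l := c / (c + Q).
have cQ : 0 < c + Q by rewrite ltr_wpDr.
have l0 : 0 < l by rewrite divr_gt0.
have l1 : l <= 1 by rewrite ler_pdivrMr // mul1r lerDl.
have := pmin _ (cX _ _ _ Xp Xy (ltW l0) l1).
rewrite norm2_leP (_ : z - (p + l *: (y - p)) = (z - p) - l *: (y - p));
  last by rewrite opprD addrA.
rewrite (dot_sub (z - p)) dotZl !dotZr -/c -/Q => h.
have lcQ : l * (c + Q) = c by rewrite /l divfK // gt_eqF.
have : l * (2 * c - l * Q) <= 0 by nra.
rewrite pmulr_rle0 // => h2; nra.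
Qed.

(** The potential is the squared distance [d t] from the iterate to its comparator. The points [xb]
    lie between the two projections; [n] counts the transitions between the [n.+1] rounds. *)
Lemma ogd_bound (x xs xb g : nat -> I -> R) (n : nat) (eta D : R) :
  0 < eta -> 0 <= D ->
  norm2 (x 0%N - xs 0%N) <= D ->
  (forall t, (t < n)%N ->
    [/\ norm2 (xb t - xs t) <= norm2 (x t + eta *: g t - xs t),
        norm2 (x t.+1 - xs t.+1) <= norm2 (xb t - xs t.+1),
        norm2 (xb t - xs t) <= D & norm2 (xb t - xs t.+1) <= D]) ->
  \sum_(t < n.+1) dot (g t) (xs t - x t) <=
    (D ^+ 2 + 2 * D * \sum_(t < n) norm2 (xs t - xs t.+1)) / (2 * eta)
    + eta / 2 * \sum_(t < n.+1) norm2 (g t) ^+ 2.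
Proof.
move=> eta0 D0 hD0 hstep.
pose d t := norm2 (x t - xs t) ^+ 2.
have step t z : norm2 (x t + eta *: g t - z) ^+ 2 =
    norm2 (x t - z) ^+ 2 - 2 * eta * dot (g t) (z - x t) + eta ^+ 2 * norm2 (g t) ^+ 2.
  rewrite !norm2_sqr (_ : x t + eta *: g t - z = (x t - z) - (- eta) *: g t); last first.
    by rewrite scaleNr opprK addrAC.
  rewrite (dot_sub (x t - z)) dotZl !dotZr -(opprB (x t) z) dotNr (dotC (x t - z)); ring.
have partial m : (m <= n)%N ->
  2 * eta * \sum_(t < m) dot (g t) (xs t - x t) + d m <=
    D ^+ 2 + 2 * D * \sum_(t < m) norm2 (xs t - xs t.+1)
    + eta ^+ 2 * \sum_(t < m) norm2 (g t) ^+ 2.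
  elim: m => [|m IH] mn.
    by rewrite !big_ord0 !mulr0 add0r !addr0 lerXn2r ?nnegrE ?norm2_ge0.
  rewrite !big_ord_recr /=; have {IH} := IH (ltnW mn).
  have [h1 h2 h3 h4] := hstep m mn.
  have h5 := norm2_sub_triangle (xb m) (xs m) (xs m.+1).
  have h6 : norm2 (xb m - xs m) ^+ 2 <= norm2 (x m + eta *: g m - xs m) ^+ 2.
    by rewrite lerXn2r ?nnegrE ?norm2_ge0.
  have h7 : d m.+1 <= norm2 (xb m - xs m.+1) ^+ 2.
    by rewrite lerXn2r ?nnegrE ?norm2_ge0.
  (* A difference of squares: the two distances differ by at most the move of the comparator, and
     their sum is at most [2 * D]. *)
  have h8 : norm2 (xb m - xs m.+1) ^+ 2 <=
      norm2 (xb m - xs m) ^+ 2 + 2 * D * norm2 (xs m - xs m.+1).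
    have := norm2_ge0 (xb m - xs m); have := norm2_ge0 (xb m - xs m.+1).
    have := norm2_ge0 (xs m - xs m.+1).
    move: h3 h4 h5; move: (norm2 _) (norm2 _) (norm2 _) => p q r *.
    have [|] := leP p q => *; nra.
  rewrite step -/(d m) in h6; lra.
have := partial n (leqnn n); rewrite !big_ord_recr /=.
(* No projection follows the last gradient step; nonnegativity of the squared distance after that
   step suffices for its round. *)
have := sqr_ge0 (norm2 (x n + eta *: g n - xs n)); rewrite step -/(d n).
set a := \sum_(t < n) dot _ _; set b := \sum_(t < n) norm2 _.
set c := \sum_(t < n) _ => h1 h2.
have e2 : 0 < 2 * eta by rewrite mulr_gt0.
rewrite -(ler_pM2l e2); set X := D ^+ 2 + _ in h2 *.
have -> : 2 * eta * (X / (2 * eta) + eta / 2 * (c + norm2 (g n) ^+ 2)) =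
    X + eta ^+ 2 * (c + norm2 (g n) ^+ 2) by field; rewrite gt_eqF.
move: h1 h2; lra.
Qed.

(** With [Q = D * (D + 2 * PT)] the left side is [(Q / eta + eta * (T * V)) / 4], and the chosen
    [eta] makes the two summands equal. *)
Lemma step_size_bound (D PT T V eta : R) : 0 < D -> 0 <= PT -> 0 < T -> 0 < V ->
  eta = Num.sqrt (D * (D + 2 * PT) / (T * V)) ->
  D ^+ 2 / (4 * eta) + D * PT / (2 * eta) + eta * T * V / 4 =
  1 / 2 * Num.sqrt (D * (D + 2 * PT) * T * V).
Proof.
move=> D0 PT0 T0 V0 ->; set Q := D * (D + 2 * PT).
have Q0 : 0 < Q by rewrite mulr_gt0 // ltr_pwDl // mulr_ge0.
have TV : 0 < T * V by rewrite mulr_gt0.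
rewrite (_ : Q * T * V = Q / (T * V) * (T * V) ^+ 2); last first.
  by field; rewrite !gt_eqF.
rewrite (@sqrtrM _ (Q / (T * V))); last by rewrite ltW // divr_gt0.
rewrite sqrtr_sqr ger0_norm; last exact: ltW.
set e := Num.sqrt _.
have e0 : 0 < e by rewrite sqrtr_gt0 divr_gt0.
have eQ : e ^+ 2 * (T * V) = Q by rewrite sqr_sqrtr ?divr_ge0 ?ltW // divfK // gt_eqF.
have -> : D ^+ 2 / (4 * e) + D * PT / (2 * e) + e * T * V / 4 = (Q / e + e * (T * V)) / 4.
  by rewrite /Q; field; rewrite gt_eqF.
by rewrite -eQ; field; rewrite gt_eqF.
Qed.

End Geometry.

(** * The feasible set: convexity, compactness, isometric embedding *)

Section Nearest.
Context {R : realType} {N : finType} {A : N -> finType} {I : finType}.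
Local Notation Omega := {i : N & A i}.
Variable p : Omega -> I -> bool.

(** An abstract form of [embed], where [p e c] says that the pair [e] is stored at coordinate
    [c]. *)
Definition gather (x : Omega -> R) : I -> R := fun c => \sum_(e | p e c) x e.

Lemma feasible_convex : convex (@feasible R N A).
Proof.
have mid (u v a : R) : u + a * (v - u) = (1 - a) * u + a * v by ring.
move=> x y a [[x01 _] x1] [[y01 _] y1] a0 a1.
have s1 i : \sum_(b : A i) (x + a *: (y - x)) (Tagged A b) = 1.
  rewrite (eq_bigr (fun b : A i => (1 - a) * x (Tagged A b) + a * y (Tagged A b))) => [|b _].
    by rewrite big_split /= -!mulr_sumr x1 y1 !mulr1 subrK.
  exact: mid.
split=> //; split=> [e|i]; last by rewrite s1.
rewrite [X in 0 <= X <= 1](_ : _ = (1 - a) * x e + a * y e); last exact: mid.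
have /andP[x0 x1'] := x01 e; have /andP[y0 y1'] := y01 e; apply/andP; split; nra.
Qed.

Lemma gatherB x y : gather (x - y) = gather x - gather y.
Proof. by apply/funext => c; exact: sumrB. Qed.

Lemma gatherD x y : gather (x + y) = gather x + gather y.
Proof. by apply/funext => c; exact: big_split. Qed.

Lemma gatherZ a x : gather (a *: x) = a *: gather x.
Proof. by apply/funext => c; rewrite -[RHS]/(a * \sum_(e | p e c) x e) mulr_sumr. Qed.

Lemma gather_convex : convex (gather @` @feasible R N A).
Proof.
move=> _ _ a [x fx <-] [y fy <-] a0 a1; exists (x + a *: (y - x)).
  exact: feasible_convex.
by rewrite gatherD gatherZ gatherB.
Qed.

Let unvec (v : 'rV[R]_#|{: Omega}|) : Omega -> R := fun e => v ord0 (enum_rank e).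

Lemma continuous_sum (T : topologicalType) (J : Type) (r : seq J) (P : pred J)
    (f : J -> T -> R) :
  (forall j, continuous (f j)) -> continuous (fun v => \sum_(j <- r | P j) f j v).
Proof.
move=> cf; elim: r => [|j r IH].
  by under eq_fun do rewrite big_nil; exact: cst_continuous.
under eq_fun do rewrite big_cons; case: (P j) => // v.
by apply: (@cvgD _ R); [exact: cf|exact: IH].
Qed.

(** In row vectors the feasible set is the unit cube, which is compact, cut by the closed conditions
    that each agent's coordinates sum to 1. *)
Lemma feasible_compact : compact [set v | feasible (unvec v)].
Proof.
pose S i (v : 'rV[R]_#|{: Omega}|) : R := \sum_(a : A i) unvec v (Tagged A a).
have cS i : continuous (S i).
  by apply: continuous_sum => a; exact: coord_continuous.
rewrite (_ : mkset _ = [set v : 'rV[R]_#|{: Omega}| | forall k, `[0, 1]%classic (v ord0 k)] `&`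
    \bigcap_(i in [set: N]) (S i @^-1` [set 1])); last first.
  apply/seteqP; split=> [v [[v01 _] v1]|v [v01 v1]].
    split=> [k|i _]; last exact: v1.
    by have := v01 (enum_val k); rewrite /= in_itv /unvec enum_valK.
  have sv i : S i v = 1 by exact: v1.
  split=> //; split=> [e|i]; last by rewrite [leLHS]sv.
  by have := v01 (enum_rank e); rewrite /= in_itv.
apply: (subclosed_compact _ (rV_compact (fun=> @segment_compact R 0 1))); last first.
  by move=> v [].
apply: closedI.
  rewrite (_ : mkset _ = \bigcap_(k in [set: 'I__])
      ((fun v : 'rV[R]_#|{: Omega}| => v ord0 k) @^-1` `[0, 1]%classic)).
    by apply: closed_bigI => k _; apply: preimage_closed => [v _|];
      [exact: coord_continuous|exact: interval_closed].
  by apply/seteqP; split => v h k; [move=> _|]; exact: h.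
by apply: closed_bigI => i _; apply: preimage_closed => [v _|]; [exact: cS|exact: closed_eq].
Qed.

(** The distance to [z] is pulled back along [gather] to a continuous function on a nonempty compact
    set, where it attains its minimum. *)
Lemma gather_nearest (x0 : Omega -> R) : feasible x0 -> has_nearest (gather @` @feasible R N A).
Proof.
move=> fx0 z.
pose f v := norm2 (z - gather (unvec v)).
have cf : continuous f.
  pose h v := dot (z - gather (unvec v)) (z - gather (unvec v)).
  move=> v; apply: (@continuous_comp _ _ _ h Num.sqrt); last exact: sqrt_continuous.
  move: v; apply: continuous_sum => c v.
  have hc : {for v, continuous (fun v => z c - gather (unvec v) c)}.
    apply: (@continuousB _ _ _ (fun=> z c) (fun v => gather (unvec v) c) v);
      first exact: cst_continuous.
    by move: v; apply: continuous_sum => e; exact: coord_continuous.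
  exact: (continuousM hc hc).
pose vec (x : Omega -> R) : 'rV[R]_#|{: Omega}| := \row_k x (enum_val k).
have vecK x : unvec (vec x) = x.
  by apply/funext => e; rewrite /unvec mxE enum_rankK.
have ne : [set v | feasible (unvec v)] !=set0 by exists (vec x0); rewrite /= vecK.
have [v vf vmin] := compact_EVT_min ne feasible_compact (continuous_subspaceT cf).
exists (gather (unvec v)); first by exists (unvec v) => //; rewrite inE in vf.
move=> _ [x fx <-]; have := vmin (vec x); rewrite /f vecK; apply.
by rewrite inE /= vecK.
Qed.

Hypothesis pinj : forall e e' c, p e c -> p e' c -> e = e'.
Hypothesis ptot : forall e, exists! c, p e c.

(** Each pair occupies exactly one coordinate and no coordinate is shared, so no cross terms
    arise. *)
Lemma dot_gather x y : dot (gather x) (gather y) = dot x y.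
Proof.
rewrite /dot /gather; under eq_bigr do rewrite mulr_suml.
rewrite (exchange_big_dep xpredT) //=; apply: eq_bigr => e _.
have [c [ec uc]] := ptot e.
rewrite (big_pred1 c) => [|c' /=]; last first.
  by apply/idP/eqP => [/uc|->].
rewrite (big_pred1 e) // => e' /=.
by apply/idP/eqP => [/pinj/(_ ec)|->].
Qed.

End Nearest.

(** * Expectations along the trajectory *)

Section Expectation.
Context {R : realType} {d : measure_display} {W : measurableType d}.
Variable P : probability W R.
Implicit Types (f g X Y Z : W -> R).

Definition bounded_rv f := exists C, forall w, `|f w| <= C.

Local Notation integ f := (P.-integrable [set: W] (EFin \o f)).
Local Notation E f := (\int[P]_w f w).

Lemma bounded_integrable f : measurable_fun [set: W] f -> bounded_rv f -> integ f.
Proof.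
move=> mf [C fC]; apply: measurable_bounded_integrable => //.
  exact: le_lt_trans (probability_le1 P measurableT) (ltry _).
by exists C; split=> [|x Cx w _]; [exact: num_real|exact: le_trans (fC w) (ltW Cx)].
Qed.

Lemma integrable_mulbr f g : integ f -> measurable_fun [set: W] g -> bounded_rv g ->
  integ (fun w => f w * g w).
Proof.
move=> fi mg [C gC].
have := @integrableMl _ _ _ P _ measurableT (EFin \o f) g fi mg; apply.
by exists C; split=> [|x Cx w _]; [exact: num_real|exact: le_trans (gC w) (ltW Cx)].
Qed.

Lemma integ_add f g : integ f -> integ g -> integ (fun w => f w + g w).
Proof. exact: integrableD. Qed.

Lemma integ_sub f g : integ f -> integ g -> integ (fun w => f w - g w).
Proof. exact: integrableB. Qed.

Lemma integ_scale (k : R) f : integ f -> integ (fun w => k * f w).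
Proof. exact: integrableZl. Qed.

Lemma integ_sum (J : Type) (r : seq J) (Q : pred J) (F : J -> W -> R) :
  (forall j, Q j -> integ (F j)) -> integ (fun w => \sum_(j <- r | Q j) F j w).
Proof.
move=> iF; rewrite (_ : _ \o _ = fun w => (\sum_(j <- r | Q j) (F j w)%:E)%E).
  exact: integrable_sum.
by apply/funext => w; rewrite /= sumEFin.
Qed.

Lemma Rintegral_sum (J : Type) (r : seq J) (Q : pred J) (F : J -> W -> R) :
  (forall j, Q j -> integ (F j)) ->
  E (fun w => \sum_(j <- r | Q j) F j w) = \sum_(j <- r | Q j) E (F j).
Proof.
move=> iF; elim: r => [|j r IH].
  by under eq_Rintegral do rewrite big_nil; rewrite Rintegral_cst // mul0r big_nil.
rewrite big_cons; under eq_Rintegral do rewrite big_cons.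
case Qj: (Q j) => //; rewrite RintegralD ?IH //; first exact: iF.
exact: integ_sum.
Qed.

Lemma integ_measurable f : integ f -> measurable_fun [set: W] f.
Proof. by move=> fi; apply/measurable_EFinP; exact: measurable_int fi. Qed.

(* The test function is rounded down to multiples of [1 / n.+1]; the rounded
   function is a combination of indicators of events of [H]. *)
Lemma condexp_test (H : set (set W)) X Y Z : is_condexp P H X Y ->
  measurable_fun [set: W] Z -> preimage_set_system [set: W] Z measurable `<=` H ->
  bounded_rv Z -> E (fun w => X w * Z w) = E (fun w => Y w * Z w).
Proof.
move=> [iX iY _ XY] mZ ZH bZ; have [C ZC] := bZ.
pose D w := X w - Y w.
have iD : integ D by exact: integ_sub.
have iDn : integ (fun w => `|D w|) by exact: integrable_norm.
suff D0 : E (fun w => D w * Z w) = 0.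
  apply/eqP; rewrite -subr_eq0 -RintegralB //; try exact: integrable_mulbr.
  by rewrite -[eqbRHS]D0; apply/eqP/eq_Rintegral => w _; rewrite mulrBl.
pose I := E (fun w => `|D w|).
have I0 : 0 <= I by apply: Rintegral_ge0.
have C0 : 0 <= C by exact: le_trans (normr_ge0 _) (ZC point).
(* The bound is the rounding error [1 / n.+1] times the mean of [|D|]; a large [n] brings it below
   any [e > 0]. *)
suff bnd n : `|E (fun w => D w * Z w)| <= n.+1%:R^-1 * I.
  apply/eqP; rewrite -normr_le0; apply/ler_addgt0Pr => e e0.
  rewrite add0r; apply: le_trans (bnd (Num.truncn (I / e))) _.
  rewrite ler_pdivrMl // mulrC -ler_pdivrMl // mulrC; apply/ltW.
  by have /andP[] := truncn_itv (divr_ge0 I0 (ltW e0)).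
(* [u w] is the index of the cell of width [1 / n.+1] containing [Z w], counted from [- C]. Only [m]
   cells occur because [Z + C] is at most [2 * C]; [c k] is the left end of cell [k]. *)
pose u w := Num.truncn (n.+1%:R * (Z w + C)).
have ZC0 w : 0 <= n.+1%:R * (Z w + C).
  by rewrite mulr_ge0 // -lerBlDr sub0r; have := ZC w; rewrite ler_norml => /andP[].
pose m := (Num.truncn (n.+1%:R * (2 * C))).+1.
have um w : (u w < m)%N.
  rewrite ltnS /u; apply: le_truncn.
  rewrite ler_pM2l // mulr2n mulrDl mul1r lerD2r.
  exact: le_trans (ler_norm _) (ZC w).
pose c (k : nat) : R := k%:R / n.+1%:R - C.
pose K (k : nat) := Z @^-1` `[c k, c k.+1[.
have Ku k w : (w \in K k) = (u w == k).
  apply/idP/idP => [|uk].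
    rewrite inE /K /= in_itv /= /u truncn_eq //.
    by rewrite lerBlDr ltrBrDr ler_pdivrMr // ltr_pdivlMr // ![_ * n.+1%:R]mulrC.
  rewrite inE /K /= in_itv /=; move: uk; rewrite /u truncn_eq //.
  by rewrite lerBlDr ltrBrDr ler_pdivrMr // ltr_pdivlMr // ![_ * n.+1%:R]mulrC.
have HK k : H (K k).
  by apply: ZH; exists `[c k, c k.+1[%classic; rewrite ?setTI //; exact: measurable_itv.
have mK k : measurable (K k).
  by rewrite -[K k]setTI; apply: mZ => //; exact: measurable_itv.
pose Zn w := c (u w).
have ZnE w : Zn w = \sum_(k < m) c k * \1_(K k) w.
  rewrite (bigD1 (Ordinal (um w))) //= indicE Ku eqxx mulr1 big1 ?addr0 // => k.
  by rewrite -val_eqE /= indicE Ku eq_sym => /negbTE ->; rewrite mulr0.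
have iDK k : integ (fun w => D w * \1_(K k) w).
  apply: integrable_mulbr => //.
  by exists 1 => w; rewrite indicE; case: (_ \in _); rewrite ?normr1 ?normr0.
have DZn : E (fun w => D w * Zn w) = 0.
  under eq_Rintegral do rewrite ZnE mulr_sumr.
  under eq_Rintegral do under eq_bigr do rewrite mulrCA.
  rewrite Rintegral_sum => [|k _]; last exact: integ_scale.
  rewrite big1 // => k _; rewrite RintegralZl //.
  suff -> : E (fun w => D w * \1_(K k) w) = 0 by rewrite mulr0.
  transitivity (\int[P]_(w in K k) D w).
    rewrite [RHS]Rintegral_mkcond; apply: eq_Rintegral => w _.
    by rewrite patchE indicE; case: (w \in K k); rewrite ?mulr1 ?mulr0.
  have iXK : P.-integrable (K k) (EFin \o X) by exact: integrableS iX.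
  have iYK : P.-integrable (K k) (EFin \o Y) by exact: integrableS iY.
  by rewrite RintegralB // /Rintegral XY ?subrr.
have mZn : measurable_fun [set: W] Zn.
  rewrite (_ : Zn = fun w => \sum_(k < m) c k * \1_(K k) w); last exact/funext.
  by apply: measurable_sum => k; apply: measurable_funM.
have Zclose w : `|Z w - Zn w| <= n.+1%:R^-1.
  have := truncn_itv (ZC0 w); rewrite -/(u w) -[(u w).+1]addn1 natrD => /andP[h1 h2].
  have n0 : 0 < n.+1%:R :> R by [].
  rewrite ler_norml /Zn /c; apply/andP; split.
    have : (u w)%:R / n.+1%:R <= Z w + C by rewrite ler_pdivrMr // mulrC.
    have : 0 < n.+1%:R^-1 :> R by rewrite invr_gt0.
    move: (_ / _) => a; move: (_^-1) => b; lra.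
  have : Z w + C <= ((u w)%:R + 1) / n.+1%:R by rewrite ler_pdivlMr // mulrC ltW.
  rewrite mulrDl mul1r; move: (_ / _) => a; move: (_^-1) => b; lra.
have bZn : bounded_rv Zn.
  exists (n.+1%:R^-1 + C) => w; rewrite -[Zn w](subKr (Z w)).
  rewrite (le_trans (ler_normB _ _)) // addrC lerD // ?Zclose //.
have iDZ := integrable_mulbr iD mZ bZ.
have iDZn := integrable_mulbr iD mZn bZn.
rewrite -[X in `|X|]subr0 -DZn -RintegralB //.
apply: le_trans (le_normr_Rintegral _ _) _ => //.
  exact: integ_sub.
rewrite -RintegralZl //; apply: le_Rintegral => //.
- by apply: integrable_norm; exact: integ_sub.
- exact: integ_scale.
- move=> w _; rewrite -mulrBr normrM mulrC; apply: ler_wpM2r => //.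
Qed.

End Expectation.

(** * Uniform bounds on values and gradients *)

Section Bounds.
Context {R : realType}.

Lemma norm2_le_dot (I : finType) (u : I -> R) : norm2 u <= 1 + dot u u.
Proof. by rewrite -norm2_sqr; have := sqr_ge0 (norm2 u - 1 / 2); nra. Qed.

Lemma exists_bound (b : nat -> R) n : exists K, forall t, (t < n)%N -> b t <= K.
Proof.
elim: n => [|n [K hK]]; first by exists 0.
exists (Num.max K (b n)) => t; rewrite ltnS leq_eqVlt => /predU1P[->|/hK tK].
  by rewrite le_max lexx orbT.
by rewrite le_max tK.
Qed.

Context {N : finType} {A : N -> finType}.
Local Notation Omega := {i : N & A i}.
Implicit Types (F : {set Omega} -> R) (x : Omega -> R).

Lemma dot_feasible x : feasible x -> dot x x <= \sum_(e : Omega) 1.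
Proof.
move=> [[x01 _] _]; apply: ler_sum => e _.
by have /andP[x0 x1] := x01 e; rewrite mulr_ile1.
Qed.

(** The linear upper bound at the zero vector, where [pme F] vanishes and its partial derivatives
    are at most [b]. *)
Lemma pme_le F (b : R) x : (forall B, 0 <= F B) -> normalized F -> monotone_set F ->
  submodular F -> (forall e, marginal F e finset.set0 <= b) -> polytope x ->
  pme F x <= \sum_(e : Omega) b.
Proof.
move=> F0 Fn Fm Fs Fb px.
have := pme_sub_le_dot Fm Fs (@polytope0 R N A) px.
rewrite [pme F 0]pmeE mixs0 Fn subr0 => /le_trans; apply.
apply: ler_sum => e _; have [/(_ e)/andP[x0 x1] _] := px.
have p0 := pderiv_ge0 Fm e (@polytope0 R N A).
have p1 := le_trans (pderiv_le Fm Fs e (@polytope0 R N A)) (Fb e).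
by rewrite -[b]mulr1 ler_pM.
Qed.

Lemma dot_grad_le F (b : R) x : monotone_set F ->
  submodular F -> (forall e, marginal F e finset.set0 <= b) -> polytope x ->
  dot (grad (pme F) x) (grad (pme F) x) <= \sum_(e : Omega) b ^+ 2.
Proof.
move=> Fm Fs Fb px; apply: ler_sum => e _; rewrite gradE.
have p0 := pderiv_ge0 Fm e px; have p1 := le_trans (pderiv_le Fm Fs e px) (Fb e).
by rewrite -expr2 lerXn2r ?nnegrE // (le_trans p0).
Qed.

End Bounds.

(** * Measurability of inner products, norms and maxima *)

Section Measurability.
Context {R : realType} {d : measure_display} {W : measurableType d}.

Lemma measurable_dot (I : finType) (u v : W -> I -> R) :
  (forall i, measurable_fun [set: W] (fun w => u w i)) ->
  (forall i, measurable_fun [set: W] (fun w => v w i)) ->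
  measurable_fun [set: W] (fun w => dot (u w) (v w)).
Proof. by move=> mu mv; apply: measurable_sum => i; exact: measurable_funM. Qed.

Lemma measurable_norm2 (I : finType) (u : W -> I -> R) :
  (forall i, measurable_fun [set: W] (fun w => u w i)) ->
  measurable_fun [set: W] (fun w => norm2 (u w)).
Proof.
move=> mu; apply: measurableT_comp; last exact: measurable_dot.
by apply: continuous_measurable_fun; exact: sqrt_continuous.
Qed.

Lemma measurable_bigmax (J : Type) (r : seq J) (Q : pred J) (f0 : W -> R) (f : J -> W -> R) :
  measurable_fun [set: W] f0 -> (forall j, measurable_fun [set: W] (f j)) ->
  measurable_fun [set: W] (fun w => \big[Num.max/f0 w]_(j <- r | Q j) f j w).
Proof.
move=> m0 mf; elim: r => [|j r IH]; first by under eq_fun do rewrite big_nil.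
under eq_fun do rewrite big_cons; case: (Q j) => //.
exact: measurable_maxr.
Qed.

End Measurability.

(** * Bounds over all rounds and the common Euclidean space *)

Section Rounds.
Context {R : realType} {d : measure_display} {St : measurableType d}.
Variable M : system R St.
Hypothesis hF : forall (t : nat) (s : St), (t < horizon M)%N ->
  [/\ normalized (util M t s), monotone_set (util M t s) & submodular (util M t s)].
Hypothesis hB : forall t : nat, (t < horizon M)%N -> bounded_marginals (util M t).

Lemma pme_bounded t : (t < horizon M)%N ->
  exists C, forall s (x : Omega M t -> R), feasible x -> `|pme (util M t s) x| <= C.
Proof.
move=> tT; have [b hb] := hB tT; exists (\sum_(e : Omega M t) b) => s x [px _].
have [Fn Fm Fs] := hF s tT.
rewrite ger0_norm; last by apply: pme_nonneg => // B; exact: util_ge0.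
apply: pme_le => // [B|e]; first exact: util_ge0.
have /(hb _ e s)/andP[] // : indep (finset.set0 : {set Omega M t}).
by apply/indepP => e1 e2; rewrite inE.
Qed.

Lemma util_bounded t : (t < horizon M)%N ->
  exists C, forall s (c : profile (act M t)), `|util M t s (action_set c)| <= C.
Proof.
move=> tT; have [C hC] := pme_bounded tT; exists C => s c.
by rewrite -pme_pure; apply: hC; exact: pure_feasible.
Qed.

Lemma grad_bounded t : (t < horizon M)%N ->
  exists C, forall s (x : Omega M t -> R), feasible x ->
    dot (grad (pme (util M t s)) x) (grad (pme (util M t s)) x) <= C.
Proof.
move=> tT; have [b hb] := hB tT; exists (\sum_(e : Omega M t) b ^+ 2) => s x [px _].
have [Fn Fm Fs] := hF s tT.
apply: dot_grad_le => // e.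
have /(hb _ e s)/andP[] // : indep (finset.set0 : {set Omega M t}).
by apply/indepP => e1 e2; rewrite inE.
Qed.

Lemma grad_bound_ub t s (x : Omega M t -> R) : (t < horizon M)%N -> feasible x ->
  norm2 (grad (pme (util M t s)) x) <= grad_bound M.
Proof.
move=> tT fx; apply: ub_le_sup; last by exists t, x, s.
(* The condition on the round is placed under the existential so that a constant can be chosen for
   every [t'], with 0 beyond the horizon. *)
have hC t' : exists C, (t' < horizon M)%N -> forall s (x : Omega M t' -> R), feasible x ->
    dot (grad (pme (util M t' s)) x) (grad (pme (util M t' s)) x) <= C.
  have [t'T|nt'] := boolP (t' < horizon M)%N; last by exists 0.
  by have [C hC] := grad_bounded t'T; exists C.
have [C {}hC] := choice hC; have [K hK] := exists_bound C (horizon M).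
exists (1 + K) => r [t' [x' [s' [t'T fx' ->]]]].
by apply: le_trans (norm2_le_dot _) _; rewrite lerD2l (le_trans _ (hK _ t'T)) ?hC.
Qed.

Section Embedding.
Variable E : embedding M.

Let occupies t (e : Omega M t) (c : 'I_(Nmax M) * 'I_(Namax M)) : bool :=
  (slot E (val (tag e)) == c.1) && (act_slot E (tagged e) == c.2).

Lemma embedE t (x : Omega M t -> R) : embed E x = gather (@occupies t) x.
Proof. by []. Qed.

Lemma embedB t (x y : Omega M t -> R) : embed E (x - y) = embed E x - embed E y.
Proof. exact: gatherB. Qed.

Lemma dot_embed t (x y : Omega M t -> R) : (t < horizon M)%N ->
  dot (embed E x) (embed E y) = dot x y.
Proof.
move=> tT; rewrite !embedE; apply: dot_gather => [e e' c|[i a]].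
  move=> /andP[/eqP se /eqP ae] /andP[/eqP se' /eqP ae'].
  case: e se ae => i a; case: e' se' ae' => i' a' /= si' ai' si ai.
  have ii' : i = i' by apply: (slot_inj tT); exact: etrans si (esym si').
  case: i' / ii' a' {si'} ai' => a' ai'; congr existT.
  exact: (act_slot_inj tT (etrans ai (esym ai'))).
exists (Ordinal (slot_lt E i tT), Ordinal (act_slot_lt E a tT)); split.
  by rewrite /occupies /= !eqxx.
move=> [c1 c2] /andP[/= /eqP h1 /eqP h2].
by congr (_, _); apply: val_inj.
Qed.

Lemma norm2_embed t (x : Omega M t -> R) : (t < horizon M)%N ->
  norm2 (embed E x) = norm2 x.
Proof. by move=> tT; rewrite /norm2 dot_embed. Qed.

Lemma efeasible_convex t : convex (efeasible E t).
Proof. exact: gather_convex. Qed.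

Lemma efeasible_nearest t (x : Omega M t -> R) : feasible x -> has_nearest (efeasible E t).
Proof. exact: gather_nearest. Qed.

(** The supremum defining [diam] is over a bounded set, since norms of feasible points are bounded
    uniformly over the rounds. *)
Lemma diam_ub t u x y : (t < horizon M)%N -> (u < horizon M)%N ->
  efeasible E t x -> efeasible E u y -> norm2 (x - y) <= diam E.
Proof.
move=> tT uT fx fy; apply: ub_le_sup; last by exists t, u, x, y.
have [K hK] := exists_bound (fun t' => \sum_(e : Omega M t') 1 : R) (horizon M).
have n2 v z : (v < horizon M)%N -> efeasible E v z -> norm2 z <= 1 + K.
  move=> vT [z' fz' <-]; rewrite norm2_embed //.
  apply: le_trans (norm2_le_dot _) _; rewrite lerD2l.
  exact: le_trans (dot_feasible fz') (hK _ vT).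
exists (1 + K + (1 + K)) => r [t' [u' [x' [y' [t'T u'T fx' fy' ->]]]]].
apply: le_trans (norm2_triangle _ _) _.
have -> : norm2 (- y') = norm2 y' by rewrite /norm2 dotNl dotNr opprK.
by apply: lerD; [exact: n2 fx'|exact: n2 fy'].
Qed.

End Embedding.
End Rounds.

(** * Expected regret along the dynamics *)

Section Trajectory.
Context {R : realType} {d : measure_display} {St : measurableType d}.
Variable M : system R St.
Hypothesis hF : forall (t : nat) (s : St), (t < horizon M)%N ->
  [/\ normalized (util M t s), monotone_set (util M t s) & submodular (util M t s)].
Hypothesis hB : forall t : nat, (t < horizon M)%N -> bounded_marginals (util M t).
Context {dW : measure_display} {W : measurableType dW}.
Variables (P : probability W R) (E : embedding M) (tau : trajectory M W).
Variables (xs : forall t : nat, St -> Omega M t -> R) (eta : R).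
Hypotheses (mU : util_measurable M) (hxs : optimal_selection xs) (eta0 : 0 < eta).
Hypothesis dyn : dynamics P tau E eta.

Local Notation integ f := (P.-integrable [set: W] (EFin \o f)).
Local Notation Ex f := (\int[P]_w f w).
Local Notation s t w := (state tau t w).
Local Notation x t w := (@marg _ _ _ _ _ _ tau t w).
Local Notation g t w := (@gest _ _ _ _ _ _ tau t w).
Local Notation a t w := (@play _ _ _ _ _ _ tau t w).
Local Notation u t w := (@xs t (state tau t w)).
Local Notation f t w := (pme (util M t (state tau t w))).
Local Notation dg t w := (@true_grad _ _ _ _ _ _ tau t w).

Lemma util_state_meas t B : (t < horizon M)%N ->
  measurable_fun [set: W] (fun w => util M t (s t w) B).
Proof.
move=> tT; apply: (measurableT_comp (f := fun s => util M t s B)).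
  exact: mU.
exact: state_meas dyn _ tT.
Qed.

Lemma opt_sel_meas t e : (t < horizon M)%N -> measurable_fun [set: W] (fun w => u t w e).
Proof.
move=> tT; apply: (measurableT_comp (f := fun s => @xs t s e)).
  by have [+ _] := hxs tT; apply.
exact: state_meas dyn _ tT.
Qed.

(** This makes functions of the current state admissible as test functions in [condexp_test]. *)
Lemma state_comp_events t (h : St -> R) : measurable_fun [set: St] h ->
  preimage_set_system [set: W] (fun w => h (s t w)) measurable `<=` state_events tau t.
Proof.
move=> mh _ [B mB <-]; exists (h @^-1` B) => //.
by rewrite -[h @^-1` B]setTI; exact: mh.
Qed.

Lemma opt_sel_feasible t w : (t < horizon M)%N -> feasible (u t w).
Proof. by move=> tT; have [_ /(_ (s t w))[]] := hxs tT. Qed.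

Lemma feasible_bounded t (z : W -> Omega M t -> R) e :
  (forall w, feasible (z w)) -> bounded_rv (fun w => z w e).
Proof.
move=> fz; exists 1 => w; have [[/(_ e)/andP[z0 z1] _] _] := fz w.
by rewrite ger0_norm.
Qed.

Lemma true_grad_bounded t e : (t < horizon M)%N -> bounded_rv (fun w => dg t w e).
Proof.
move=> tT; have [C hC] := grad_bounded hF hB tT; exists (1 + C) => w.
have := hC (s t w) _ (marg_feasible dyn w tT); rewrite -/(dg t w) => h.
have : dg t w e ^+ 2 <= C.
  apply: le_trans h; rewrite /dot (bigD1 e) //= expr2 lerDl.
  by apply: sumr_ge0 => i _; rewrite -expr2 sqr_ge0.
rewrite -real_normK ?num_real // => h2.
by have := sqr_ge0 (`|dg t w e| - 1 / 2); nra.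
Qed.

Lemma util_play t w : util M t (s t w) (action_set (a t w)) =
  \sum_(c : profile (act M t))
    \1_[set w | a t w = c] w * util M t (s t w) (action_set c).
Proof.
rewrite (bigD1 (a t w)) //= indicE mem_set // mul1r big1 ?addr0 // => c cp.
by rewrite indicE memNset ?mul0r // => /= pc; rewrite pc eqxx in cp.
Qed.

Lemma util_action_bounded t c : (t < horizon M)%N ->
  bounded_rv (fun w => util M t (s t w) (action_set c)).
Proof. by move=> tT; have [C hC] := util_bounded hF hB tT; exists C. Qed.

(** The realized utility is a sum over profiles of an indicator times a bounded function of the
    state. Conditioning on the past replaces each indicator by its probability, and the sum is then
    [pme] by [pme_profile]. *)
Lemma Ex_play t : (t < horizon M)%N ->
  [/\ integ (fun w => f t w (x t w)) &
   Ex (fun w => util M t (s t w) (action_set (a t w))) = Ex (fun w => f t w (x t w))].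
Proof.
move=> tT.
have fE w : f t w (x t w) = \sum_(c : profile (act M t))
    profile_prob (x t w) c * util M t (s t w) (action_set c).
  by rewrite pme_profile //; exact: (marg_feasible dyn w tT).
have bU c := util_action_bounded c tT.
have mUc c := util_state_meas (action_set c) tT.
have i1 c : integ (fun w => \1_[set w | a t w = c] w * util M t (s t w) (action_set c)).
  by apply: integrable_mulbr => //; have [] := play_law dyn c tT.
have i2 c : integ (fun w => profile_prob (x t w) c * util M t (s t w) (action_set c)).
  by apply: integrable_mulbr => //; have [] := play_law dyn c tT.
have -> : (fun w => f t w (x t w)) = fun w => \sum_(c : profile (act M t))
    profile_prob (x t w) c * util M t (s t w) (action_set c) by exact/funext.
split; first exact: integ_sum.
under eq_Rintegral do rewrite util_play.
rewrite !Rintegral_sum //; apply: eq_bigr => c _.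
apply: (condexp_test (Z := fun w => util M t (s t w) (action_set c)) (play_law dyn c tT)) => //.
have sH := @state_comp_events t (fun s => util M t s (action_set c)) (mU _ tT).
by move=> K /sH sK; apply: sub_gen_smallest; left; exists t => //=; left.
Qed.

Lemma Ex_opt t : (t < horizon M)%N ->
  [/\ integ (fun w => opt (util M t (s t w))) &
   fine (\int[state_dist P tau t]_s (opt (util M t s))%:E)%E =
     Ex (fun w => opt (util M t (s t w)))].
Proof.
move=> tT.
have opt0 s' : 0 <= opt (util M t s').
  rewrite /opt; apply: (big_ind (fun r => 0 <= r)); first exact: util_ge0.
    by move=> r r' r0 r'0; rewrite le_max r0.
  by move=> B _; exact: util_ge0.
have [C hC] := pme_bounded hF hB tT.
have optC s' : opt (util M t s') <= C.
  apply: opt_le; first by move=> i; exact: act_gt0.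
    by have [] := hF s' tT.
  by move=> y fy; exact: le_trans (ler_norm _) (hC _ _ fy).
have mopt : measurable_fun [set: St] (fun s => opt (util M t s)).
  by apply: measurable_bigmax => [|B]; exact: mU.
have ms := state_meas dyn tT.
split.
  apply: bounded_integrable; last by exists C => w; rewrite ger0_norm.
  exact: (measurableT_comp mopt ms).
rewrite /state_dist ge0_integral_pushforward //.
  by apply/measurable_EFinP.
by move=> y _; rewrite lee_fin.
Qed.

Lemma unbiased_test t (Z : W -> Omega M t -> R) : (t < horizon M)%N ->
  (forall e, measurable_fun [set: W] (fun w => Z w e)) ->
  (forall e, preimage_set_system [set: W] (fun w => Z w e) measurable `<=` current tau t) ->
  (forall e, bounded_rv (fun w => Z w e)) ->
  [/\ integ (fun w => dot (g t w) (Z w)), integ (fun w => dot (dg t w) (Z w)) &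
  Ex (fun w => dot (g t w) (Z w)) = Ex (fun w => dot (dg t w) (Z w))].
Proof.
move=> tT mZ HZ bZ; have ge e := gest_unbiased dyn e tT.
have i1 e : integ (fun w => g t w e * Z w e).
  by apply: integrable_mulbr => //; have [] := ge e.
have i2 e : integ (fun w => dg t w e * Z w e).
  by apply: integrable_mulbr => //; have [] := ge e.
split; try exact: integ_sum.
rewrite !Rintegral_sum //; apply: eq_bigr => e _.
exact: (condexp_test (Z := fun w => Z w e) (ge e)).
Qed.

Lemma true_grad_meas t e : (t < horizon M)%N -> measurable_fun [set: W] (fun w => dg t w e).
Proof. by move=> tT; have [_ i _ _] := gest_unbiased dyn e tT; exact: integ_measurable i. Qed.

Lemma unbiased_opt t : (t < horizon M)%N ->
  [/\ integ (fun w => dot (g t w) (u t w)), integ (fun w => dot (dg t w) (u t w)) &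
  Ex (fun w => dot (g t w) (u t w)) = Ex (fun w => dot (dg t w) (u t w))].
Proof.
move=> tT; apply: unbiased_test => // e; first exact: opt_sel_meas.
  have [/(_ e)/state_comp_events sH _] := hxs tT.
  by move=> K /sH sK; apply: sub_gen_smallest; left.
by apply: (@feasible_bounded t (fun w => u t w) e) => w; exact: opt_sel_feasible.
Qed.

Lemma unbiased_marg t : (t < horizon M)%N ->
  [/\ integ (fun w => dot (g t w) (x t w)), integ (fun w => dot (dg t w) (x t w)) &
  Ex (fun w => dot (g t w) (x t w)) = Ex (fun w => dot (dg t w) (x t w))].
Proof.
move=> tT; apply: unbiased_test => // e; first exact: (marg_meas dyn e tT).
  by move=> K sK; apply: sub_gen_smallest; right; exists e.
by apply: (@feasible_bounded t (fun w => x t w) e) => w; exact: (marg_feasible dyn w tT).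
Qed.

(** The true gradient is itself a bounded function measurable for [current], so it may serve as a
    test function. *)
Lemma unbiased_grad t : (t < horizon M)%N ->
  [/\ integ (fun w => dot (g t w) (dg t w)), integ (fun w => dot (dg t w) (dg t w)) &
  Ex (fun w => dot (g t w) (dg t w)) = Ex (fun w => dot (dg t w) (dg t w))].
Proof.
move=> tT; apply: unbiased_test => // e; first exact: true_grad_meas.
  by have [_ _] := gest_unbiased dyn e tT.
exact: true_grad_bounded.
Qed.

(** The bias-variance identity: by [unbiased_grad] the second moment of the estimate is its variance
    plus the mean squared norm of the true gradient. *)
Lemma Ex_gest_sqr t : (t < horizon M)%N ->
  integ (fun w => norm2 (g t w) ^+ 2) /\
  Ex (fun w => norm2 (g t w) ^+ 2) <= grad_bound M ^+ 2 + sigma2 P tau.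
Proof.
move=> tT; have [igd idd gd] := unbiased_grad tT.
have idev : integ (fun w => norm2 (g t w - dg t w) ^+ 2).
  apply/integrableP; split.
    apply/measurable_EFinP; apply: measurable_funX; apply: measurable_norm2 => e.
    by apply: measurable_funB; [exact: (gest_meas dyn e tT)|exact: true_grad_meas].
  have := gest_var dyn tT; rewrite /grad_var unlock.
  by under [X in _ -> (X < _)%E]eq_integral do rewrite /= ger0_norm ?sqr_ge0 //.
have dev_le : Ex (fun w => norm2 (g t w - dg t w) ^+ 2) <= sigma2 P tau.
  rewrite /sigma2 (bigD1 (Ordinal tT)) //= /grad_var unlock.
  by rewrite le_max lexx.
have sqE w : norm2 (g t w) ^+ 2 =
    (norm2 (g t w - dg t w) ^+ 2 + 2 * dot (g t w) (dg t w)) - dot (dg t w) (dg t w).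
  by rewrite !norm2_sqr dot_sub; ring.
have i1 : integ (fun w => 2 * dot (g t w) (dg t w)) by exact: integ_scale.
have i2 := integ_add idev i1.
have -> : (fun w => norm2 (g t w) ^+ 2) = fun w =>
    (norm2 (g t w - dg t w) ^+ 2 + 2 * dot (g t w) (dg t w)) - dot (dg t w) (dg t w).
  exact/funext.
split; first exact: integ_sub.
rewrite RintegralB // RintegralD // RintegralZl // gd.
suff : Ex (fun w => dot (dg t w) (dg t w)) <= grad_bound M ^+ 2 by lra.
rewrite -[leRHS]mulr1 -[X in _ * X](_ : fine (P [set: W]) = 1); last first.
  by rewrite probability_setT.
rewrite -Rintegral_cst //; apply: le_Rintegral => //.
  by apply: bounded_integrable => //; exists `|grad_bound M ^+ 2|.
move=> w _; rewrite -norm2_sqr.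
have h := grad_bound_ub hF hB (s t w) tT (marg_feasible dyn w tT).
by rewrite lerXn2r ?nnegrE ?norm2_ge0 // (le_trans (norm2_ge0 _) h).
Qed.

Lemma embed_meas t c : (t < horizon M)%N ->
  measurable_fun [set: W] (fun w => embed E (u t w) c).
Proof.
move=> tT; pose b (e : Omega M t) :=
  (slot E (val (tag e)) == c.1) && (act_slot E (tagged e) == c.2).
rewrite (_ : (fun w => _) = fun w => \sum_e if b e then u t w e else 0).
  by apply: measurable_sum => e; case: (b e) => //; exact: opt_sel_meas.
by apply/funext => w; rewrite /embed big_mkcond.
Qed.

Lemma path_term_meas t : (t.+1 < horizon M)%N ->
  measurable_fun [set: W] (fun w => norm2 (embed E (u t w) - embed E (u t.+1 w))).
Proof.
move=> tT; apply: measurable_norm2 => c.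
by apply: measurable_funB; apply: embed_meas => //; exact: ltnW.
Qed.

Lemma ltn_predS t : (t < (horizon M).-1)%N -> (t.+1 < horizon M)%N.
Proof. by move=> h; rewrite -(prednK (horizon_gt0 M)) ltnS. Qed.

Lemma ogd_pointwise w :
  \sum_(t < horizon M) dot (g t w) (u t w - x t w) <=
    (diam E ^+ 2 + 2 * diam E * \sum_(t < (horizon M).-1)
       norm2 (embed E (u t w) - embed E (u t.+1 w))) / (2 * eta)
    + eta / 2 * \sum_(t < horizon M) norm2 (g t w) ^+ 2.
Proof.
have T0 := horizon_gt0 M.
have fu t : (t < horizon M)%N -> efeasible E t (embed E (u t w)).
  by move=> tT; exists (u t w) => //; exact: opt_sel_feasible.
have fx t : (t < horizon M)%N -> efeasible E t (embed E (x t w)).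
  by move=> tT; exists (x t w) => //; exact: (marg_feasible dyn w tT).
have near t : (t < horizon M)%N -> has_nearest (efeasible E t).
  by move=> tT; exact: efeasible_nearest (opt_sel_feasible w tT).
pose xb t := proj_onto (efeasible E t) (embed E (x t w) + eta *: embed E (g t w)).
have fxb t : (t < horizon M)%N -> efeasible E t (xb t).
  by move=> tT; have [] := proj_ontoP (embed E (x t w) + eta *: embed E (g t w)) (near t tT).
(* Everything is embedded in the common space; [(horizon M).-1] is the number of transitions between
   consecutive rounds. *)
have := @ogd_bound _ _ (fun t => embed E (x t w)) (fun t => embed E (u t w)) xb
  (fun t => embed E (g t w)) (horizon M).-1 eta (diam E) eta0 _ _ _.
rewrite prednK // => h.
have {h} := h _ _ _.
have -> : \sum_(t < horizon M) dot (embed E (g t w)) (embed E (u t w) - embed E (x t w)) =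
    \sum_(t < horizon M) dot (g t w) (u t w - x t w).
  by apply: eq_bigr => t _; rewrite -embedB dot_embed.
have -> : \sum_(t < horizon M) norm2 (embed E (g t w)) ^+ 2 =
    \sum_(t < horizon M) norm2 (g t w) ^+ 2.
  by apply: eq_bigr => t _; rewrite norm2_embed.
apply.
- exact: (le_trans (norm2_ge0 _) (diam_ub T0 T0 (fx _ T0) (fu _ T0))).
- exact: (diam_ub T0 T0 (fx _ T0) (fu _ T0)).
- move=> t /ltn_predS tT; have tT' := ltnW tT; split.
  + apply: proj_onto_contract; [exact: near|exact: efeasible_convex|exact: fu].
  + rewrite (marg_step dyn w tT).
    apply: proj_onto_contract; [exact: near|exact: efeasible_convex|exact: fu].
  + exact: (diam_ub tT' tT' (fxb _ tT') (fu _ tT')).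
  + exact: (diam_ub tT' tT (fxb _ tT') (fu _ tT)).
Qed.

(** Pointwise, OPT is at most the value at the best feasible point, to which the half-gradient
    inequality applies; unbiasedness then replaces the true gradient by its estimate. *)
Lemma Ex_round t : (t < horizon M)%N ->
  1 / 2 * Ex (fun w => opt (util M t (s t w)))
    - Ex (fun w => util M t (s t w) (action_set (a t w))) <=
  1 / 2 * Ex (fun w => dot (g t w) (u t w - x t w)).
Proof.
move=> tT; have [io _] := Ex_opt tT; have [ix ->] := Ex_play tT.
have [gu1 gu2 gu3] := unbiased_opt tT; have [gx1 gx2 gx3] := unbiased_marg tT.
have dE v w : dot v (u t w - x t w) = dot v (u t w) - dot v (x t w).
  by rewrite dotDr dotNr.
have -> : Ex (fun w => dot (g t w) (u t w - x t w)) =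
    Ex (fun w => dot (dg t w) (u t w) - dot (dg t w) (x t w)).
  under eq_Rintegral do rewrite dE.
  by rewrite !RintegralB // gu3 gx3.
have i1 : integ (fun w => 1 / 2 * opt (util M t (s t w))) by exact: integ_scale.
have i2 := integ_sub gu2 gx2.
have i3 : integ (fun w => 1 / 2 * (dot (dg t w) (u t w) - dot (dg t w) (x t w))).
  exact: integ_scale.
rewrite -!RintegralZl // -RintegralB //; apply: le_Rintegral => //.
  exact: integ_sub.
move=> w _; rewrite -dE.
have [Fn Fm Fs] := hF (s t w) tT.
have fx := marg_feasible dyn w tT; have fu := opt_sel_feasible w tT.
have := pme_half (fun B => util_ge0 (s t w) B tT) Fm Fs fx.1 fu.1.
rewrite -/(dg t w); apply: le_trans; rewrite lerD2r ler_pM2l //.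
apply: opt_le => // [i|y fy]; first exact: act_gt0.
by have [_ /(_ (s t w))[_]] := hxs tT; apply.
Qed.

Lemma path_lengthE : path_length P tau E xs =
  Ex (fun w => \sum_(t < (horizon M).-1) norm2 (embed E (u t w) - embed E (u t.+1 w))).
Proof. by rewrite /path_length unlock. Qed.

Lemma path_length_ge0 : 0 <= path_length P tau E xs.
Proof.
by rewrite path_lengthE; apply: Rintegral_ge0 => w _; apply: sumr_ge0 => t _; exact: norm2_ge0.
Qed.

Lemma Ex_cst (k : R) : Ex (fun=> k) = k.
Proof. by rewrite Rintegral_cst // [X in fine X](probability_setT P) mulr1. Qed.

(** Summing [Ex_round] leaves half of the expected linear regret, which is bounded by integrating
    [ogd_pointwise] and inserting the second moments of the estimates. *)
Lemma regret_le : regret P tau (1 / 2) <=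
  diam E ^+ 2 / (4 * eta) + diam E * path_length P tau E xs / (2 * eta)
  + eta * (horizon M)%:R * (grad_bound M ^+ 2 + sigma2 P tau) / 4.
Proof.
pose Y w := \sum_(t < (horizon M).-1) norm2 (embed E (u t w) - embed E (u t.+1 w)).
pose G2 w := \sum_(t < horizon M) norm2 (g t w) ^+ 2.
have iL (t : 'I_(horizon M)) : integ (fun w => dot (g t w) (u t w - x t w)).
  have [gu1 _ _] := unbiased_opt (ltn_ord t); have [gx1 _ _] := unbiased_marg (ltn_ord t).
  under eq_fun do rewrite dotDr dotNr; exact: integ_sub.
have iY : integ Y.
  apply: integ_sum => t _; have tT := ltn_predS (ltn_ord t).
  apply: bounded_integrable; first exact: path_term_meas.
  exists (diam E) => w; rewrite ger0_norm ?norm2_ge0 //.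
  apply: (diam_ub (ltnW tT) tT).
    by exists (u t w) => //; exact: (opt_sel_feasible w (ltnW tT)).
  by exists (u t.+1 w) => //; exact: opt_sel_feasible.
have iG2 : integ G2 by apply: integ_sum => t _; have [] := Ex_gest_sqr (ltn_ord t).
have EG2 : Ex G2 <= (horizon M)%:R * (grad_bound M ^+ 2 + sigma2 P tau).
  rewrite Rintegral_sum => [|t _]; last by have [] := Ex_gest_sqr (ltn_ord t).
  apply: (@le_trans _ _ (\sum_(t < horizon M) (grad_bound M ^+ 2 + sigma2 P tau))).
    by apply: ler_sum => t _; have [] := Ex_gest_sqr (ltn_ord t).
  by rewrite sumr_const card_ord mulr_natl.
have ic (k : R) : integ (fun=> k).
  by apply: bounded_integrable => //; exists `|k|.
have i1 : integ (fun w => 2 * diam E * Y w) by exact: integ_scale.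
have i2 := integ_add (ic (diam E ^+ 2)) i1.
have i3 : integ (fun w => (2 * eta)^-1 * (diam E ^+ 2 + 2 * diam E * Y w)) by exact: integ_scale.
have i4 : integ (fun w => eta / 2 * G2 w) by exact: integ_scale.
have ogd : Ex (fun w => \sum_(t < horizon M) dot (g t w) (u t w - x t w)) <=
    (2 * eta)^-1 * (diam E ^+ 2 + 2 * diam E * path_length P tau E xs) + eta / 2 * Ex G2.
  apply: (@le_trans _ _ (Ex (fun w =>
      (2 * eta)^-1 * (diam E ^+ 2 + 2 * diam E * Y w) + eta / 2 * G2 w))).
    apply: le_Rintegral => //; [exact: integ_sum|exact: integ_add|move=> w _].
    by have := ogd_pointwise w; rewrite [(_ + _) / (2 * eta)]mulrC.
  by rewrite RintegralD // !RintegralZl // RintegralD // RintegralZl // Ex_cst path_lengthE.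
have step : regret P tau (1 / 2) <=
    1 / 2 * Ex (fun w => \sum_(t < horizon M) dot (g t w) (u t w - x t w)).
  rewrite Rintegral_sum // mulr_sumr; apply: ler_sum => t _.
  have [_ ->] := Ex_opt (ltn_ord t); rewrite unlock.
  exact: Ex_round.
apply: le_trans step _.
have h1 : 1 / 2 * Ex (fun w => \sum_(t < horizon M) dot (g t w) (u t w - x t w)) <=
   1 / 2 * ((2 * eta)^-1 * (diam E ^+ 2 + 2 * diam E * path_length P tau E xs) +
     eta / 2 * ((horizon M)%:R * (grad_bound M ^+ 2 + sigma2 P tau))).
  rewrite ler_pM2l // (le_trans ogd) // lerD2l ler_pM2l // divr_gt0 //.
apply: le_trans h1 _; rewrite le_eqVlt; apply/orP; left; apply/eqP.
by field; rewrite gt_eqF.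
Qed.

End Trajectory.

Theorem theorem5p2 (R : realType) (d : measure_display) (St : measurableType d)
    (M : system R St)
    (hF : forall (t : nat) (s : St), (t < horizon M)%N ->
       [/\ normalized (util M t s),
           monotone_set (util M t s) &
           submodular (util M t s)])
    (hB : forall t : nat, (t < horizon M)%N ->
       bounded_marginals (util M t)) :
  (forall (t : nat) (s : St), (t < horizon M)%N ->
     let f := pme (util M t s) in
     [/\ nonneg_on polytope f, monotone_on polytope f,
         dr_submodular_on polytope f &
         forall x y : Omega M t -> R, feasible x -> feasible y ->
           1 / 2 * f y - f x <= 1 / 2 * dot (grad f x) (y - x)]) /\
  (forall (dW : measure_display) (W : measurableType dW) (P : probability W R)
     (E : embedding M) (tau : trajectory M W)
     (xs : forall t : nat, St -> Omega M t -> R) (eta : R),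
     util_measurable M ->
     optimal_selection xs ->
     0 < eta ->
     dynamics P tau E eta ->
     let T := (horizon M)%:R in
     let D := diam E in
     let V := grad_bound M ^+ 2 + sigma2 P tau in
     let PT := path_length P tau E xs in
     regret P tau (1 / 2) <=
       D ^+ 2 / (4 * eta) + D * PT / (2 * eta) + eta * T * V / 4 /\
     (0 < D -> 0 < V -> eta = Num.sqrt (D * (D + 2 * PT) / (T * V)) ->
      regret P tau (1 / 2) <=
        1 / 2 * Num.sqrt (D * (D + 2 * PT) * T * V))).
Proof.
split=> [t s tT f|dW W P E tau xs eta mU hxs eta0 dyn T D V PT].
  have [Fn Fm Fs] := hF t s tT; have F0 B := util_ge0 s B tT.
  split; [exact: pme_nonneg|exact: pme_monotone|exact: pme_dr|].
  by move=> x y [px _] [py _]; exact: pme_half.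
have bound := regret_le hF hB mU hxs eta0 dyn.
split=> // D0 V0 etaE.
(* For the tuned step size the general bound equals the closed form. *)
rewrite -(step_size_bound D0 _ _ V0 etaE) //; first exact: path_length_ge0.
by rewrite ltr0n horizon_gt0.
Qed.
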